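(* Let $N\ge1$, $d\ge 2$ be integers and let $B\geq 0$. There is a constant $C$ depending only on $d$, $N$ and $B$ such that for every $A\in\operatorname{SL}_N(\overline{\mathbb{Q}})$ with $h(A)\leq B$ and every $\mathbf{b}\in\overline{\mathbb{Q}}^N$ for which $f(\mathbf{X})=A\mathbf{X}^d+\mathbf{b}$ is post-critically finite, one has $h(\mathbf{b})\leq C$.
   Context: Here $\mathbf{X}^d=(X_1^d,\dots,X_N^d)$, and $f$ is identified with its extension to an endomorphism of $\mathbb{P}^N$. An endomorphism $f:\mathbb{P}^N\to\mathbb{P}^N$ is post-critically finite (PCF) if the post-critical locus $P_f=\bigcup_{n\geq1}f^n(C_f)$ is algebraic (a finite union of hypersurfaces), where $C_f$ is the critical locus, defined by the vanishing of the determinant of the Jacobian of $f$. For a number field $K$ containing all the entries, with standard absolute values $M_K$ and weights $n_v=[K_v:\mathbb{Q}_v]/[K:\mathbb{Q}]$, $h(\mathbf{b})=\sum_{v}n_v\log^+\max_i|b_i|_v$ and $h(A)=\sum_v n_v\log\max_{i,j}|A_{i,j}|_v$, where $\log^+x=\max\{\log x,0\}$. *)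

(* Defs.v *)
From HB Require Import structures.
From mathcomp Require Import all_boot all_order all_algebra all_field.
From mathcomp Require Import all_classical all_reals all_analysis.
(* The notations of the mpoly library clash with those of MathComp-Analysis. *)
From mathcomp Require Import -(notations) mpoly.

Set Implicit Arguments.
Unset Strict Implicit.
Unset Printing Implicit Defensive.

Import Order.TTheory GRing.Theory Num.Theory.
Import numFieldNormedType.Exports.

Local Open Scope classical_set_scope.
Local Open Scope ring_scope.

(** * Absolute values, places and heights *)

Section AbsoluteValues.
Variable R : realType.

Definition padic_abs (p : nat) (x : rat) : R :=
  if x == 0 then 0
  else p%:R ^+ logn p `|denq x|%N / p%:R ^+ logn p `|numq x|%N.

Definition standard_abs_rat : set (rat -> R) :=
  [set w | (forall x, w x = ratr `|x|) \/
           exists2 p : nat, prime p & forall x, w x = padic_abs p x].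

(* A number field is a [K : fieldExtType rat]; [q%:A] is the image of the
   rational number q in K. *)
Variable K : fieldExtType rat.

Definition absolute_value (v : K -> R) : Prop :=
  [/\ forall x, 0 <= v x,
      forall x, v x = 0 <-> x = 0,
      forall x y, v (x * y) = v x * v y
    & forall x y, v (x + y) <= v x + v y].

(* M_K: the absolute values on K whose restriction to Q is standard.  Distinct
   elements are inequivalent, so this is also the set of places of K. *)
Definition standard_abs : set (K -> R) :=
  [set v | absolute_value v /\ standard_abs_rat (fun q : rat => v q%:A)].

(* The completion K_v is the ring of v-Cauchy sequences in K modulo the null
   sequences, and Q_v is its subfield of classes of Cauchy sequences of
   rational numbers.  We work with representatives. *)
Definition abs_cauchy (v : K -> R) (x : nat -> K) : Prop :=
  forall e : R, 0 < e ->
    exists m, forall i j, (m <= i)%N -> (m <= j)%N -> v (x i - x j) < e.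

Definition abs_null (v : K -> R) (x : nat -> K) : Prop :=
  (fun k => v (x k)) @ \oo --> (0 : R).

(* The classes of e_0, ..., e_(n-1) form a basis of K_v over Q_v. *)
Definition completion_basis (v : K -> R) (n : nat) (e : 'I_n -> nat -> K) :
    Prop :=
  [/\ forall i, abs_cauchy v (e i),
      forall x, abs_cauchy v x ->
        exists2 c : 'I_n -> nat -> rat,
          forall i, abs_cauchy v (fun k => (c i k)%:A) &
          abs_null v (fun k => x k - \sum_(i < n) (c i k)%:A * e i k)
    & forall c : 'I_n -> nat -> rat,
        (forall i, abs_cauchy v (fun k => (c i k)%:A)) ->
        abs_null v (fun k => \sum_(i < n) (c i k)%:A * e i k) ->
        forall i, abs_null v (fun k => (c i k)%:A)].

(* [K_v : Q_v]; [xget] returns the unique n admitting a basis of size n. *)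
Definition local_degree (v : K -> R) : nat :=
  xget 0%N [set n | exists e : 'I_n -> nat -> K, completion_basis v e].

Definition local_weight (v : K -> R) : R :=
  (local_degree v)%:R / (\dim {:K})%:R.

(* The library sets [ln 0 = 0], which agrees with log^+ 0 = 0. *)
Definition log_plus (x : R) : R := Num.max (ln x) 0.

(* [\sum_(v \in D) F v] is the sum over the v in D with F v != 0; in both
   heights these are finite in number, for a nonzero matrix in [height_mx].
   The value 0 used to start the maxima is harmless as v >= 0. *)
Definition height_vec (N : nat) (b : 'cV[K]_N) : R :=
  \sum_(v \in standard_abs)
     local_weight v * log_plus (\big[Num.max/0]_(i < N) v (b i 0)).

Definition height_mx (N : nat) (A : 'M[K]_N) : R :=
  \sum_(v \in standard_abs)
     local_weight v *
       ln (\big[Num.max/0]_(i < N) \big[Num.max/0]_(j < N) v (A i j)).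

End AbsoluteValues.

(** * Post-critically finite endomorphisms of projective space *)

Section Projective.
Variables (F : closedFieldType) (N : nat).

(* A subset of P^N(F) is given by the set of all homogeneous coordinate vectors
   of its points: a set of nonzero vectors, stable under nonzero scaling. *)
Local Notation coords := ('I_N.+1 -> F).

Definition nonzero_coords (x : coords) : Prop := exists i, x i != 0.

Definition proj_zeros (p : mpoly N.+1 F) : set coords :=
  [set x | nonzero_coords x /\ meval x p = 0].

Definition is_hypersurface (S : set coords) : Prop :=
  exists (k : nat) (p : mpoly N.+1 F),
    [/\ (0 < k)%N, p != 0, p \is ishomog1 k mdeg & S = proj_zeros p].

Definition algebraic_locus (S : set coords) : Prop :=
  exists (m : nat) (H : 'I_m -> set coords),
    (forall i, is_hypersurface (H i)) /\ S = \bigcup_i H i.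

(* A morphism P^N -> P^N is given by N+1 forms f_0, ..., f_N of the same degree
   without common zero in P^N. *)
Variable f : 'I_N.+1 -> mpoly N.+1 F.

Definition proj_image (S : set coords) : set coords :=
  [set y | exists (x : coords) (c : F),
     [/\ S x, c != 0 & forall i, y i = c * meval x (f i)]].

Definition jacobian_det : mpoly N.+1 F :=
  \det (\matrix_(i < N.+1, j < N.+1) mderiv j (f i)).

Definition critical_locus : set coords := proj_zeros jacobian_det.

Definition postcritical_locus : set coords :=
  \bigcup_(n in [set n | (1 <= n)%N]) iter n proj_image critical_locus.

Definition PCF : Prop := algebraic_locus postcritical_locus.

End Projective.

(* The homogenization of X |-> A X^d + b with respect to the extra coordinate
   X_0; the affine coordinate X_k is the homogeneous coordinate of index
   [lift ord0 k]. *)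
Definition power_affine_map (F : closedFieldType) (N d : nat)
    (A : 'M[F]_N) (b : 'cV[F]_N) : 'I_N.+1 -> mpoly N.+1 F :=
  let X i := mpolyX F (mnm1 i) in
  fun i => if unlift ord0 i is Some k
           then \sum_(j < N) A k j *: X (lift ord0 j) ^+ d
                + b k 0 *: X ord0 ^+ d
           else X ord0 ^+ d.

(* Main.v *)
From HB Require Import structures.
Require Import Defs.
From mathcomp Require Import all_boot all_order all_algebra all_field.
From mathcomp Require Import all_classical all_reals all_analysis.
From mathcomp Require Import -(notations) mpoly.
From mathcomp Require Import ring lra zify.
Set Implicit Arguments.
Unset Strict Implicit.
Unset Printing Implicit Defensive.
Import Order.TTheory GRing.Theory Num.Theory.
Import numFieldNormedType.Exports.
Local Open Scope classical_set_scope.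
Local Open Scope ring_scope.

(** Why the theorem holds.  Write g for the map x |-> A x^d + b of the affine
    space of dimension N, where x^d is taken coordinatewise.  The bound is purely
    local: at every place v of K,

      max_i |b_i|_v <= kappa^(3d+3) (kappa max_ij |A_ij|_v)^((N+1)(d+1)),

    where kappa is 1 at a finite place and max(2, N!) at an infinite one
    ([log_bound_of_extension]).  Summing its logarithm against the local
    weights gives the theorem.

    Local bound ([local_bound]).  Extend v to an absolute value W of algC.  The
    critical locus of g contains the hyperplanes H_j = {x_j = 0}, and a point y
    of g(H_j) satisfies (A^-1 y)_j = (A^-1 b)_j.  If |b| is too large compared
    with A, choose j for which |(A^-1 b)_j| is maximal: then every point of
    g(H_j) is so large that g multiplies its norm by a factor lambda > 1, and
    the same holds at all later points of its orbit.  So the points of g^n(H_j)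
    tend to infinity uniformly with n.  On the other hand post-critical
    finiteness puts all the g^n(H_j) into one algebraic hypersurface
    ([pcf_vanishing]), and this forces each of them to have a point in a ball
    that does not depend on n ([trapped_zeros]): the image g^n(H_j) is the zero
    set of a polynomial P ([iter_pushforward], by taking norms along x |-> x^d),
    and if w is a direction that is not a limit of points of the affine part of
    the hypersurface, P has a zero u + t w with |u| <= 1, and there the
    hypersurface bounds |t|.

    Extending v.  At a finite place, a subring of algC that is maximal among
    those containing the unit ball of v but not 1/p is a valuation ring, and as
    algC is algebraic over K its value group is torsion over that of K; this
    makes the valuation real ([nonarchimedean_extension]).  At an infinite
    place, v is the usual absolute value composed with an embedding: otherwise
    weak approximation would give an element of K that is large at v while all
    its conjugates are small ([archimedean_embedding]).

    Summation.  By weak approximation and the equivalence of norms on K_v over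
    Q_v, the local degrees over one place of Q add up to at most [K : Q]
    ([sum_local_degree]).  Hence the infinite places have total weight at most 1,
    and only finitely many places with a nonzero weight lie over each p.  At a
    finite place over p, max |A_ij|_v >= 1 because det A = 1, and |A_ij|_v > 1 only
    if p divides a denominator of A_ij ([padic_denominator]).  So the sum that
    defines h(A) has finitely many nonzero terms and can be compared with that of
    h(b) term by term ([height_bound]). *)

(** * Polynomials and the images of hypersurfaces *)

Lemma base_digits_inj n D (a b : 'I_n -> nat) :
  (forall i, a i < D)%N -> (forall i, b i < D)%N ->
  (\sum_(i < n) a i * D ^ i = \sum_(i < n) b i * D ^ i)%N -> a =1 b.
Proof.
elim: n a b => [|n IHn] a b ltaD ltbD; first by move=> _ [].
rewrite !big_ord_recl /= !expn0 !muln1.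
have shift (c : 'I_n.+1 -> nat) : (\sum_(i < n) c (lift ord0 i) * D ^ bump 0 i =
    (\sum_(i < n) c (lift ord0 i) * D ^ i) * D)%N.
  by rewrite big_distrl; apply: eq_bigr => i _ /=; rewrite /bump expnS mulnAC mulnA.
rewrite !shift => eq_ab.
have eq0 : a ord0 = b ord0.
  have := congr1 (modn^~ D) eq_ab.
  by rewrite ![(_ ord0 + _)%N]addnC !modnMDl !modn_small.
have D_gt0 : (0 < D)%N by exact: leq_ltn_trans (ltaD ord0).
move: eq_ab; rewrite eq0 => /addnI/eqP; rewrite eqn_pmul2r // => /eqP eqS i.
have [j ->|->//] := unliftP ord0 i.
by apply: (IHn (a \o lift ord0) (b \o lift ord0)) => // k /=.
Qed.

Lemma horner_nonroot (F : idomainType) (q : {poly F}) (s : nat -> F) :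
  injective s -> q != 0 -> exists k, q.[s k] != 0.
Proof.
move=> inj_s q0; apply: contrapT => noroot.
have: (size (map s (iota 0 (size q))) < size q)%N.
  apply: max_poly_roots => //; last by rewrite map_inj_uniq ?iota_uniq.
  by apply/allP=> _ /mapP[k _ ->]; apply/eqP; apply: contrapT => /eqP nz; apply: noroot; exists k.
by rewrite size_map size_iota ltnn.
Qed.

(** Kronecker's substitution X_i := T^(D^i) sends distinct monomials of degree
    less than D to distinct powers of T, so a nonzero polynomial stays nonzero.
    Powers of a single s k are used as coordinates because such points are
    bounded by 1 as soon as s k is. *)
Lemma mpoly_nonvanishing (F : fieldType) n (p : mpoly n F) (s : nat -> F) :
  injective s -> p != 0 ->
  exists (e : 'I_n -> nat) (k : nat), meval (fun i => s k ^+ e i) p != 0.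
Proof.
move=> inj_s p0; set D := mmeasure mdeg p; exists (fun i : 'I_n => D ^ i)%N.
pose w (m : multinom n) := (\sum_(i < n) m i * D ^ i)%N.
pose q : {poly F} := \sum_(m <- msupp p) mcoeff m p *: 'X^(w m).
have ltD m i : m \in msupp p -> (m i < D)%N.
  move=> hm; apply: (@leq_ltn_trans (mdeg m)); last exact: mmeasure_mnm_lt.
  by rewrite mdegE (bigD1 i) //= leq_addr.
have inj_w : {in msupp p &, injective w}.
  move=> m m' hm hm' eqw; apply/mnmP => i.
  by apply: (base_digits_inj (D := D)) => // j; apply: ltD.
have qE k : q.[s k] = meval (fun i => s k ^+ (D ^ i)) p.
  rewrite mevalE horner_sum; apply: eq_bigr => m _; rewrite hornerZ hornerXn.
  by congr (_ * _); rewrite /w -prodrXr; apply: eq_bigr => i _; rewrite mulnC exprM.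
suff /(horner_nonroot inj_s)[k]: q != 0 by rewrite qE; exists k.
have [m hm] : exists m, m \in msupp p.
  case E: (msupp p) => [|m l]; last by exists m; rewrite inE eqxx.
  by move: p0; rewrite -msupp_eq0 E.
apply/eqP => /(congr1 (fun r : {poly F} => r`_(w m))); rewrite coef0 coef_sum.
rewrite (bigD1_seq m) ?msupp_uniq //= coefZ coefXn eqxx mulr1 big_seq_cond big1.
  by move/eqP; rewrite addr0; apply/negP; rewrite -mcoeff_msupp.
move=> m' /andP[hm' neq]; rewrite coefZ coefXn; case: eqP => [/inj_w e|_]; last by rewrite mulr0.
by rewrite e ?eqxx // in neq.
Qed.

Definition dilate (F : fieldType) n (c : 'I_n -> F) (p : mpoly n F) : mpoly n F :=
  comp_mpoly [tuple c i *: mpolyX F (mnm1 i) | i < n] p.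

Lemma mcoeff_dilate (F : fieldType) n (c : 'I_n -> F) (p : mpoly n F) m :
  mcoeff m (dilate c p) = (\prod_i c i ^+ m i) * mcoeff m p.
Proof.
rewrite {1}/dilate comp_mpolyEX.
have monE (m' : multinom n) : comp_mpoly [tuple c i *: mpolyX F (mnm1 i) | i < n] (mpolyX F m') =
    (\prod_i c i ^+ m' i) *: mpolyX F m'.
  rewrite comp_mpolyX [in RHS]mpolyXE_id -scaler_prod; apply: eq_bigr => i _.
  by rewrite tnth_mktuple exprZn.
rewrite raddf_sum /= [in RHS](mpolyE p) raddf_sum /= mulr_sumr; apply: eq_bigr => m' _.
rewrite monE !mcoeffZ mcoeffX; case: eqP => [->|_]; last by rewrite !mulr0.
by rewrite !mulr1 mulrC.
Qed.

Lemma meval_dilate (F : fieldType) n (c : 'I_n -> F) (p : mpoly n F) x :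
  meval x (dilate c p) = meval (fun i => c i * x i) p.
Proof.
rewrite /dilate comp_mpoly_meval; apply: meval_eq => i.
by rewrite tnth_mktuple mevalZ mevalXU.
Qed.

(** A polynomial invariant under the multiplication of each variable by a
    primitive d-th root of unity involves only exponents divisible by d. *)
Lemma descend_power (F : fieldType) n d (z : F) (q : mpoly n F) :
  d.-primitive_root z ->
  (forall i, dilate (fun j => if j == i then z else 1) q = q) ->
  exists r : mpoly n F, forall x, meval (fun i => x i ^+ d) r = meval x q.
Proof.
move=> zP inv_q; have d_gt0 := prim_order_gt0 zP.
have dvd m i : m \in msupp q -> (d %| m i)%N.
  rewrite mcoeff_msupp => nz; rewrite (prim_order_dvd zP).
  have := congr1 (mcoeff m) (inv_q i).
  rewrite mcoeff_dilate (bigD1 i) //= eqxx big1 ?mulr1; last first.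
    by move=> j /negbTE ->; rewrite expr1n.
  by rewrite -[RHS]mul1r => /(mulIf nz)->.
exists (\sum_(m <- msupp q) mcoeff m q *: mpolyX F (Multinom [tuple (m i %/ d)%N | i < n])).
move=> x; rewrite [RHS]mevalE raddf_sum /= big_seq [RHS]big_seq; apply: eq_bigr => m hm.
rewrite mevalZ mevalX; congr (_ * _); apply: eq_bigr => i _.
by rewrite mnmE -exprM mulnC divnK ?dvd.
Qed.

(** The image of a hypersurface under x |-> x^d is again a hypersurface: the
    product of p (e x) over all tuples e of d-th roots of unity is a polynomial
    in x^d, and it vanishes at x exactly when some e x is a zero of p. *)
Lemma power_pushforward (F : closedFieldType) n d (z : F) (s : nat -> F) (p : mpoly n F) :
  d.-primitive_root z -> injective s -> p != 0 -> (exists x, meval x p = 0) ->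
  exists r : mpoly n F, [/\ r != 0, exists y, meval y r = 0 &
    forall y, meval y r = 0 -> exists2 x, meval x p = 0 & forall i, x i ^+ d = y i].
Proof.
move=> zP inj_s p0 [x0 px0]; have := prim_order_gt0 zP.
case: d zP => // d zP _.
pose q := \prod_(e : {ffun 'I_n -> 'I_d.+1}) dilate (fun i => z ^+ e i) p.
have qE x : meval x q = \prod_(e : {ffun 'I_n -> 'I_d.+1}) meval (fun i => z ^+ e i * x i) p.
  by rewrite rmorph_prod /=; apply: eq_bigr => e _; rewrite meval_dilate.
have z0 : z != 0.
  apply/eqP => z0; have := prim_expr_order zP; rewrite z0 expr0n /= => /esym/eqP.
  by rewrite oner_eq0.
have q0 : q != 0.
  rewrite prodf_seq_neq0; apply/allP => e _ /=; apply: contra_neq p0 => e0.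
  apply/mpolyP => m; rewrite mcoeff0; have := congr1 (mcoeff m) e0.
  rewrite mcoeff_dilate mcoeff0 => /eqP; rewrite mulf_eq0 => /orP[|/eqP//].
  by rewrite prodf_seq_eq0 => /hasP[i _]; rewrite /= !expf_eq0 (negbTE z0) !andbF.
have inv_q i : dilate (fun j => if j == i then z else 1) q = q.
  (* Reindexing by e + u multiplies the i-th root of unity by z; if the order of
     z is 1, inord 1 is 0 but z is 1 too. *)
  pose u : {ffun 'I_n -> 'I_d.+1} := [ffun j => if j == i then inord 1 else ord0].
  rewrite /dilate rmorph_prod /= [RHS](reindex_inj (addIr u)); apply: eq_bigr => e _.
  apply/mpolyP => m; rewrite -!/(dilate _ _) !mcoeff_dilate mulrA -big_split /=.
  congr (_ * _); apply: eq_bigr => j _; rewrite -exprMn; congr (_ ^+ _).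
  rewrite !ffunE /= (prim_expr_mod zP) exprD mulrC; congr (_ * _).
  case: ifP => [_|_]; last by rewrite expr0.
  have [d_eq0|d_gt0] := posnP d; last by rewrite inordK ?expr1.
  by have := prim_expr_order zP; rewrite {1}d_eq0 expr1 => ->; rewrite expr1n.
have [r rE] := descend_power zP inv_q.
exists r; split.
- have [e [k]] := mpoly_nonvanishing inj_s q0; rewrite -rE; apply: contra_neq => ->.
  by rewrite meval0.
- exists (fun i => x0 i ^+ d.+1); rewrite rE qE (bigD1 (0 : {ffun 'I_n -> 'I_d.+1})) //=.
  by rewrite (meval_eq (v2 := x0)) ?px0 ?mul0r // => i; rewrite ffunE expr0 mul1r.
move=> y ry.
have root_d (a : F) : exists b, b ^+ d.+1 = a.
  have /closed_rootP[b] : size ('X^(d.+1) - a%:P) != 1%N by rewrite size_XnsubC.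
  by rewrite /root !hornerE subr_eq0 => /eqP; exists b.
have [x xE] := choice (fun i => root_d (y i)).
have : meval x q = 0 by rewrite -rE -ry; apply: meval_eq.
rewrite qE => /eqP; rewrite prodf_seq_eq0 => /hasP[e _ /= /eqP pe].
exists (fun i => z ^+ e i * x i) => // i.
by rewrite exprMn xE exprAC (prim_expr_order zP) expr1n mul1r.
Qed.

Definition affine_power_fun (F : fieldType) N d (A : 'M[F]_N) (b : 'cV[F]_N)
    (x : 'I_N -> F) : 'I_N -> F :=
  fun i => \sum_j A i j * x j ^+ d + b i 0.

Lemma mulmx_funK (F : fieldType) N (B C : 'M[F]_N) (x : 'I_N -> F) i : B *m C = 1%:M ->
  \sum_j B i j * (\sum_k C j k * x k) = x i.
Proof.
move=> BC; have := congr1 (fun M : 'cV[F]_N => M i 0) (mulmxA B C (\col_k x k)).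
rewrite BC mul1mx !mxE => <-; apply: eq_bigr => j _; rewrite mxE; congr (_ * _).
by apply: eq_bigr => k _; rewrite mxE.
Qed.

Lemma affine_power_pushforward (F : closedFieldType) N d (z : F) (s : nat -> F)
    (A : 'M[F]_N) (b : 'cV[F]_N) (p : mpoly N F) :
  d.-primitive_root z -> injective s -> A \in unitmx ->
  p != 0 -> (exists x, meval x p = 0) ->
  exists r : mpoly N F, [/\ r != 0, exists y, meval y r = 0 &
    forall y, meval y r = 0 -> exists2 x, meval x p = 0 & y = affine_power_fun d A b x].
Proof.
move=> zP inj_s uA p0 pz; have [q [q0 [y0 qy0] qz]] := power_pushforward zP inj_s p0 pz.
pose r := comp_mpoly [tuple \sum_j invmx A i j *: (mpolyX F (mnm1 j) - mpolyC N (b j 0)) | i < N] q.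
have rE y : meval y r = meval (fun i => \sum_j invmx A i j * (y j - b j 0)) q.
  rewrite /r comp_mpoly_meval; apply: meval_eq => i; rewrite tnth_mktuple raddf_sum /=.
  by apply: eq_bigr => j _; rewrite mevalZ mevalB mevalXU mevalC.
have rAb y : meval (fun i => \sum_j A i j * y j + b i 0) r = meval y q.
  rewrite rE; apply: meval_eq => i.
  under eq_bigr do rewrite addrK.
  by rewrite mulmx_funK ?mulVmx.
exists r; split.
- have [e [k]] := mpoly_nonvanishing inj_s q0; rewrite -rAb; apply: contra_neq => ->.
  by rewrite meval0.
- by exists (fun i => \sum_j A i j * y0 j + b i 0); rewrite rAb.
move=> y; rewrite rE => /qz[x px xE]; exists x => //; apply/funext => i.
rewrite /affine_power_fun; under eq_bigr do rewrite xE.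
by rewrite mulmx_funK ?mulmxV // subrK.
Qed.

Lemma iter_pushforward (F : closedFieldType) N d (z : F) (s : nat -> F)
    (A : 'M[F]_N) (b : 'cV[F]_N) (j : 'I_N) n :
  d.-primitive_root z -> injective s -> A \in unitmx ->
  exists r : mpoly N F, [/\ r != 0, exists y, meval y r = 0 &
    forall y, meval y r = 0 -> exists2 x, x j = 0 & y = iter n (affine_power_fun d A b) x].
Proof.
move=> zP inj_s uA; elim: n => [|n [p [p0 pz pP]]].
  exists (mpolyX F (mnm1 j)); split.
  - apply/eqP => /(congr1 (meval (fun=> 1))); rewrite mevalXU meval0 => /eqP.
    by rewrite oner_eq0.
  - by exists (fun=> 0); rewrite mevalXU.
  by move=> y; rewrite mevalXU => yj; exists y.
have [r [r0 rz rP]] := affine_power_pushforward b zP inj_s uA p0 pz.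
exists r; split => // y /rP[x /pP[x' x'j ->] ->]; by exists x'.
Qed.

(** For a = 1 this is the affine point w of P^N, for a = 0 a point at infinity. *)
Definition cons_coord (T : Type) n (a : T) (w : 'I_n -> T) : 'I_n.+1 -> T :=
  fun i => if unlift ord0 i is Some k then w k else a.

(** The hypersurface p = 0 may contain the hyperplane at infinity X_0 = 0 with
    some multiplicity k.  Dividing by X_0^k, where k is the least exponent of X_0
    in p, leaves a polynomial that does not vanish identically there. *)
Lemma split_off_infinity (F : fieldType) N (s : nat -> F) (p : mpoly N.+1 F) :
  injective s -> p != 0 ->
  exists (k : nat) (q : mpoly N.+1 F) (w : 'I_N -> F),
    (forall x, meval x p = x ord0 ^+ k * meval x q) /\ meval (cons_coord 0 w) q != 0.
Proof.
move=> inj_s p0.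
have [m0 hm0] : exists m, m \in msupp p.
  case E: (msupp p) => [|m l]; last by exists m; rewrite inE eqxx.
  by move: p0; rewrite -msupp_eq0 E.
have [m1 hm1 min_m1] : exists2 m1, m1 \in msupp p & forall m, m \in msupp p -> (m1 ord0 <= m ord0)%N.
  have ex : exists k, has (fun m : multinom N.+1 => m ord0 == k) (msupp p).
    by exists (m0 ord0); apply/hasP; exists m0.
  have [k /hasP[m1 h1 /eqP <-] mink] := ex_minnP ex.
  by exists m1 => // m hm; apply: mink; apply/hasP; exists m.
set k := m1 ord0 in min_m1 *.
pose red (m : multinom N.+1) : multinom N.+1 :=
  Multinom [tuple (if i == ord0 then m i - k else m i)%N | i < N.+1].
pose q := \sum_(m <- msupp p) mcoeff m p *: mpolyX F (red m).
pose tl (m : multinom N.+1) : multinom N := Multinom [tuple m (lift ord0 i) | i < N].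
pose r := \sum_(m <- msupp p | m ord0 == k) mcoeff m p *: mpolyX F (tl m).
have r0 : r != 0.
  apply/eqP => /(congr1 (mcoeff (tl m1))); rewrite mcoeff0 /r big_mkcond raddf_sum /=.
  rewrite (bigD1_seq m1) ?msupp_uniq //= eqxx mcoeffZ mcoeffX eqxx mulr1.
  rewrite big_seq_cond big1 => [|m /andP[hm ne]].
    by rewrite addr0 => /eqP; apply/negP; rewrite -mcoeff_msupp.
  case: eqP => [mk|_]; last by rewrite mcoeff0.
  rewrite mcoeffZ mcoeffX; case: eqP => [e|_]; last by rewrite mulr0.
  case/eqP: ne; apply/mnmP => i; have [j ->|->] := unliftP ord0 i; last by rewrite mk.
  by have /mnmP/(_ j) := e; rewrite !mnmE.
have [e [l rw]] := mpoly_nonvanishing inj_s r0.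
exists k, q, (fun i => s l ^+ e i); split => [x|].
  rewrite mevalE raddf_sum mulr_sumr /= big_seq [RHS]big_seq; apply: eq_bigr => m hm.
  rewrite mevalZ mevalX mulrCA; congr (_ * _).
  rewrite !big_ord_recl mulrA -exprD !mnmE eqxx subnKC ?min_m1 //; congr (_ * _).
  by apply: eq_bigr => i _; rewrite mnmE.
move: rw; congr (_ != _); rewrite !raddf_sum /= [in LHS]big_mkcond /= big_seq [RHS]big_seq.
apply: eq_bigr => m hm; rewrite !mevalZ !mevalX big_ord_recl mnmE eqxx /cons_coord unlift_none.
have tailE : \prod_(i < N) match unlift ord0 (lift ord0 i) with
       | Some k0 => s l ^+ e k0 | None => 0 end ^+ red m (lift ord0 i) =
     \prod_(i < N) (s l ^+ e i) ^+ tl m i.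
  by apply: eq_bigr => i _; rewrite liftK !mnmE.
rewrite tailE; case: eqP => [->|/eqP ne]; first by rewrite subnn expr0 mul1r.
by rewrite expr0n subn_eq0 leqNgt ltn_neqAle eq_sym ne min_m1 // mul0r mulr0.
Qed.

Lemma homog_mevalZ (F : fieldType) n k (p : mpoly n F) (c : F) x :
  p \is ishomog1 k mdeg -> meval (fun i => c * x i) p = c ^+ k * meval x p.
Proof.
move=> /dhomogP hp; rewrite !mevalE mulr_sumr big_seq [RHS]big_seq; apply: eq_bigr => m hm.
rewrite mulrCA; congr (_ * _); have <- : mdeg m = k := hp _ hm; rewrite mdegE -prodrXr -big_split /=.
by apply: eq_bigr => i _; rewrite exprMn.
Qed.

(** * Absolute values on a field *)

Definition is_abs (R : realType) (F : fieldType) (W : F -> R) : Prop :=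
  [/\ forall x, 0 <= W x, forall x, W x = 0 <-> x = 0,
      forall x y, W (x * y) = W x * W y & forall x y, W (x + y) <= W x + W y].

Definition ultrametric (R : realType) (F : fieldType) (W : F -> R) :=
  forall x y, W (x + y) <= Num.max (W x) (W y).

Section Abs.
Variables (R : realType) (F : fieldType) (W : F -> R).
Hypothesis HW : is_abs W.

Lemma abs_ge0 x : 0 <= W x. Proof. by have [] := HW. Qed.
Lemma absM x y : W (x * y) = W x * W y. Proof. by have [_ _] := HW. Qed.
Lemma abs_triangle x y : W (x + y) <= W x + W y. Proof. by have [_ _ _] := HW. Qed.
Lemma abs0 : W 0 = 0. Proof. by have [_ + _ _] := HW; move=> ->. Qed.
Lemma abs_eq0 x : (W x == 0) = (x == 0).
Proof. by have [_ H _ _] := HW; apply/eqP/eqP => /H. Qed.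
Lemma abs_gt0 x : (0 < W x) = (x != 0).
Proof. by rewrite lt_def abs_eq0 abs_ge0 andbT. Qed.
Lemma abs1 : W 1 = 1.
Proof.
have := absM 1 1; rewrite mulr1 => /eqP; rewrite -subr_eq0 -{1}[W 1]mulr1 -mulrBr mulf_eq0.
by rewrite abs_eq0 oner_eq0 /= subr_eq0 => /eqP.
Qed.
Lemma absN1 : W (-1) = 1.
Proof.
have := absM (-1) (-1); rewrite mulrNN mulr1 abs1 => /esym/eqP; rewrite -expr2 sqrf_eq1.
by case/orP=> /eqP // E; have := abs_ge0 (-1); rewrite E oppr_ge0 ler10.
Qed.
Lemma absN x : W (- x) = W x.
Proof. by rewrite -mulN1r absM absN1 mul1r. Qed.
Lemma absX x n : W (x ^+ n) = W x ^+ n.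
Proof. by elim: n => [|n IHn]; rewrite ?expr0 ?abs1 // !exprS absM IHn. Qed.
Lemma absV x : W x^-1 = (W x)^-1.
Proof.
have [->|x0] := eqVneq x 0; first by rewrite invr0 abs0 invr0.
apply: (mulfI (x := W x)); first by rewrite abs_eq0.
by rewrite -absM !mulfV ?abs1 ?abs_eq0.
Qed.
Lemma absf x y : W (x / y) = W x / W y. Proof. by rewrite absM absV. Qed.
Lemma abs_sum I (r : seq I) (P : pred I) (f : I -> F) :
  W (\sum_(i <- r | P i) f i) <= \sum_(i <- r | P i) W (f i).
Proof.
elim/big_rec2: _ => [|i y x _ le]; first by rewrite abs0.
by apply: le_trans (abs_triangle _ _) _; rewrite lerD2l.
Qed.
Lemma abs_prod I (r : seq I) (P : pred I) (f : I -> F) :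
  W (\prod_(i <- r | P i) f i) = \prod_(i <- r | P i) W (f i).
Proof. by apply: big_morph => [x y|]; rewrite ?absM ?abs1. Qed.

Lemma meval_lipschitz n (p : mpoly n F) (rho : R) :
  exists2 K, 0 <= K & forall x y delta, 0 <= delta ->
    (forall i, W (x i) <= rho) -> (forall i, W (y i) <= rho) ->
    (forall i, W (x i - y i) <= delta) -> W (meval x p - meval y p) <= K * delta.
Proof.
pose L (f : ('I_n -> F) -> F) := exists K M : R, [/\ 0 <= K, 0 <= M,
  forall x, (forall i, W (x i) <= rho) -> W (f x) <= M &
  forall x y delta, 0 <= delta ->
    (forall i, W (x i) <= rho) -> (forall i, W (y i) <= rho) ->
    (forall i, W (x i - y i) <= delta) -> W (f x - f y) <= K * delta].
have Lc c : L (fun=> c).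
  exists 0, (W c); split => // [|x y delta *]; first exact: abs_ge0.
  by rewrite subrr abs0 mul0r.
have Lx i : L (fun x => x i).
  exists 1, `|rho|; split => // [x hx|x y delta _ _ _]; last by rewrite mul1r.
  exact: le_trans (hx i) (ler_norm _).
have LD f g : L f -> L g -> L (fun x => f x + g x).
  move=> [K [M [K0 M0 HM HK]]] [K' [M' [K'0 M'0 HM' HK']]].
  exists (K + K'), (M + M'); split=> [||x hx|x y delta d0 hx hy hd]; rewrite ?addr_ge0 //.
    by apply: le_trans (abs_triangle _ _) _; rewrite lerD ?HM ?HM'.
  rewrite opprD addrACA mulrDl; apply: le_trans (abs_triangle _ _) _.
  by rewrite lerD ?HK ?HK'.
have LM f g : L f -> L g -> L (fun x => f x * g x).
  move=> [K [M [K0 M0 HM HK]]] [K' [M' [K'0 M'0 HM' HK']]].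
  exists (K * M' + M * K'), (M * M').
  split=> [||x hx|x y delta d0 hx hy hd]; rewrite ?addr_ge0 ?mulr_ge0 //.
    by rewrite absM ler_pM ?abs_ge0 ?HM ?HM'.
  have -> : f x * g x - f y * g y = (f x - f y) * g x + f y * (g x - g y) by ring.
  apply: le_trans (abs_triangle _ _) _; rewrite !absM mulrDl lerD //.
    by rewrite mulrAC ler_pM ?abs_ge0 ?HM' ?HK.
  by rewrite -mulrA ler_pM ?abs_ge0 ?HM ?HK'.
have LX f k : L f -> L (fun x => f x ^+ k).
  move=> Lf; elim: k => [|k IHk]; first exact: (Lc 1).
  have := LM _ _ Lf IHk; congr L; apply/funext => x; exact/esym/exprS.
have Lp (r : seq 'I_n) (m : 'I_n -> nat) : L (fun x => \prod_(i <- r) x i ^+ m i).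
  elim: r => [|i r IHr].
    by under eq_fun do rewrite big_nil; exact: Lc.
  by under eq_fun do rewrite big_cons; apply: LM => //; apply: LX.
have Ls (r : seq (multinom n)) : L (fun x => \sum_(m <- r) mcoeff m p * \prod_i x i ^+ m i).
  elim: r => [|i r IHr].
    by under eq_fun do rewrite big_nil; exact: Lc.
  by under eq_fun do rewrite big_cons; apply: LD => //; apply: LM.
have [K [M [K0 _ _ HK]]] := Ls (msupp p); by exists K.
Qed.

End Abs.

Lemma is_abs_comp (R : realType) (F F' : fieldType) (f : {rmorphism F -> F'}) (W : F' -> R) :
  is_abs W -> is_abs (W \o f).
Proof.
move=> HW; split=> [x|x|x y|x y] /=; rewrite ?rmorphM ?rmorphD /= ?(abs_ge0 HW) ?(absM HW) //.
  by split=> [/eqP|->]; rewrite ?rmorph0 ?(abs0 HW) // (abs_eq0 HW) fmorph_eq0 => /eqP.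
exact: abs_triangle.
Qed.

(** Bernoulli's inequality. *)
Lemma exprn_unbounded (R : realType) (x M : R) : 1 < x -> exists n, M < x ^+ n.
Proof.
move=> x1; have h0 : 0 < x - 1 by rewrite subr_gt0.
have bern n : 1 + n%:R * (x - 1) <= x ^+ n.
  elim: n => [|n IHn]; first by rewrite mul0r addr0 expr0.
  rewrite exprS; apply: le_trans (ler_wpM2l (ltW (lt_trans ltr01 x1)) IHn).
  rewrite -subr_ge0.
  have -> : x * (1 + n%:R * (x - 1)) - (1 + n.+1%:R * (x - 1)) = n%:R * (x - 1) ^+ 2.
    by rewrite -natr1; ring.
  by rewrite mulr_ge0 ?sqr_ge0.
have [n hn] : exists n : nat, M / (x - 1) < n%:R.
  by exists (Num.trunc (`|M / (x - 1)|)).+1; apply: le_lt_trans (ler_norm _) (truncnS_gt _).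
exists n; apply: lt_le_trans (bern n); rewrite ltr_pdivrMr // in hn.
by apply: lt_trans hn _; rewrite ltrDr.
Qed.

(** If the naturals are bounded, the binomial formula gives
    W (x + y)^n <= (n + 1) max (W x, W y)^n; a polynomial in n does not dominate
    an exponential, so W (x + y) <= max (W x, W y). *)
Lemma ultrametric_of_nat (R : realType) (F : fieldType) (W : F -> R) :
  is_abs W -> (forall n : nat, W n%:R <= 1) -> ultrametric W.
Proof.
move=> HW Wn x y; set M := Num.max _ _.
have M0 : 0 <= M by rewrite le_max (abs_ge0 HW).
have bin n : W (x + y) ^+ n <= n.+1%:R * M ^+ n.
  rewrite -(absX HW) exprDn; apply: le_trans (abs_sum HW _ _ _) _.
  have -> : n.+1%:R * M ^+ n = \sum_(i < n.+1) M ^+ n by rewrite sumr_const card_ord mulr_natl.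
  apply: ler_sum => i _.
  rewrite -mulr_natr !(absM HW) !(absX HW) -[leRHS]mulr1.
  apply: ler_pM => //; rewrite ?mulr_ge0 ?exprn_ge0 ?(abs_ge0 HW) //.
  have := ltn_ord i; rewrite ltnS => le.
  have -> : M ^+ n = M ^+ (n - i) * M ^+ i by rewrite -exprD subnK.
  apply: ler_pM; rewrite ?exprn_ge0 ?(abs_ge0 HW) // lerXn2r // ?nnegrE ?(abs_ge0 HW) //.
    by rewrite le_max lexx.
  by rewrite le_max lexx orbT.
rewrite leNgt; apply/negP => lt.
have [M00|M_neq0] := eqVneq M 0.
  have := bin 1%N; rewrite M00 expr0n mulr0 expr1 leNgt => /negP; apply.
  by rewrite -M00.
have Mgt : 0 < M by rewrite lt_def M_neq0.
pose r := W (x + y) / M; have r1 : 1 < r by rewrite ltr_pdivlMr // mul1r.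
have rn n : r ^+ n <= n.+1%:R by rewrite expr_div_n ler_pdivrMr ?exprn_gt0.
have [n hn] := exprn_unbounded 2%:R r1.
have n2 m : (m.+1%:R : R) ^+ 2 <= r ^+ (n * (2 * m)).
  rewrite exprM; apply: le_trans (_ : (2%:R ^+ (2 * m)) <= _); last first.
    by rewrite lerXn2r // ?nnegrE ?ler0n ?exprn_ge0 // ltW // (lt_trans _ r1).
  rewrite mulnC exprM lerXn2r // ?nnegrE ?ler0n ?exprn_ge0 //.
  by rewrite -natrX ler_nat ltn_expl.
have n_gt0 : (0 < n)%N.
  by case: (n) hn => //; rewrite expr0 ltNge ler1n.
have := le_trans (n2 (n * 2)%N) (rn _); rewrite -natrX ler_nat.
by move: n_gt0; clear; nia.
Qed.

Lemma ultrametric_sum (R : realType) (F : fieldType) (W : F -> R) (I : finType) (f : I -> F) M :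
  is_abs W -> ultrametric W -> 0 <= M -> (forall i, W (f i) <= M) -> W (\sum_i f i) <= M.
Proof.
move=> HW UW M0 fM; elim/big_ind: _ => [|x y hx hy|i _]; rewrite ?(abs0 HW) //.
by apply: le_trans (UW x y) _; rewrite ge_max hx hy.
Qed.

(** * Zeros on bounded lines *)

Section Local.
Variables (R : realType) (F : closedFieldType) (W : F -> R) (pi : F).
Hypotheses (HW : is_abs W) (pi_gt0 : 0 < W pi) (pi_lt1 : W pi < 1).

Lemma exp_small_inj : injective (fun k => pi ^+ k).
Proof.
move=> m n /(congr1 W); rewrite !(absX HW) => E.
by apply/eqP; rewrite eqn_leq -!(ler_iXn2l pi_gt0 pi_lt1) E lexx.
Qed.

Section VNorm.
Variable N : nat.

Definition vnorm (x : 'I_N -> F) : R := \big[Num.max/0]_(i < N) W (x i).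

Lemma vnorm_ge0 x : 0 <= vnorm x.
Proof. exact: bigmax_ge_id. Qed.

Lemma vnorm_ge x i : W (x i) <= vnorm x.
Proof. exact: le_bigmax. Qed.

Lemma vnorm_le x M : 0 <= M -> (forall i, W (x i) <= M) -> vnorm x <= M.
Proof. by move=> M0 le; apply/bigmax_leP; split. Qed.

Lemma vnorm_eq x (i0 : 'I_N) : exists i, vnorm x = W (x i).
Proof.
have [i _ E] := @eq_bigmax _ R 'I_N 0 i0 xpredT (fun i => W (x i)) isT (fun i _ => abs_ge0 HW (x i)).
by exists i.
Qed.
End VNorm.

(** Any hypersurface P = 0 of affine space that lies in the projective
    hypersurface p = 0 has a point in a ball depending on p alone.

    Let p = X_0^k q and let q (0, w) be nonzero.  For t nonzero, the point u + t w
    is on p = 0 exactly when q (1/t, u/t + w) = 0.  For bounded u this is close to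
    q (0, w) when t is large, so t is bounded ([bound] below).  It remains to
    find a zero of P on a line u + F w with u in the unit ball.  If there is none,
    P is constant on all these lines since F is algebraically closed.  As the
    points u available are enough to test polynomial identities, P is then
    invariant under translation by F w; so with one zero z0 it has the whole line
    z0 + F w, on which t is unbounded. *)
Lemma trapped_zeros N (p : mpoly N.+1 F) (D : nat) :
  p != 0 -> (forall c x, meval (fun i => c * x i) p = c ^+ D * meval x p) ->
  exists M : R, forall P : mpoly N F, (exists z, meval z P = 0) ->
    (forall z, meval z P = 0 -> meval (cons_coord 1 z) p = 0) ->
    exists2 z, meval z P = 0 & vnorm z <= M.
Proof.
move=> p0 hom_p; have [k [q [w [pE qw]]]] := split_off_infinity exp_small_inj p0.
have e_gt0 : 0 < W (meval (cons_coord 0 w) q) by rewrite abs_gt0.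
have bound rho : 0 <= rho -> exists2 K, 0 <= K & forall u t, (forall i, W (u i) <= rho) ->
    1 <= W t -> meval (cons_coord 1 (fun i => u i + t * w i)) p = 0 -> W t <= K.
  move=> rho0; set eps := W _ in e_gt0.
  have [K K0 HK] := meval_lipschitz HW q (1 + rho + vnorm w).
  exists (K * (1 + rho) / eps); first by rewrite divr_ge0 ?mulr_ge0 ?addr_ge0 // ltW.
  move=> u t hu t1 pt.
  have t0 : 0 < W t := lt_le_trans ltr01 t1.
  have t_neq0 : t != 0 by rewrite -(abs_gt0 HW).
  have s1 : W t^-1 <= 1 by rewrite absV // invf_le1.
  have qt : meval (cons_coord t^-1 (fun i => t^-1 * u i + w i)) q = 0.
    have := hom_p t^-1 (cons_coord 1 (fun i => u i + t * w i)); rewrite pt mulr0.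
    rewrite pE {1}/cons_coord unlift_none mulr1 => /eqP; rewrite mulf_eq0 expf_eq0 invr_eq0.
    rewrite (negbTE t_neq0) andbF /= => /eqP qt; rewrite -[RHS]qt; apply: meval_eq => i.
    rewrite /cons_coord; case: unliftP => [j _|_]; last by rewrite mulr1.
    by rewrite mulrDr mulKf.
  have le1 : W (t^-1) * (1 + rho) <= 1 + rho by rewrite ler_piMl // addr_ge0.
  have := HK (cons_coord 0 w) (cons_coord t^-1 (fun i => t^-1 * u i + w i)) (W t^-1 * (1 + rho)).
  rewrite qt subr0 -/eps => HK'; rewrite ler_pdivlMr //.
  have {HK'} : eps <= K * (W t^-1 * (1 + rho)).
    apply: HK'; first by rewrite mulr_ge0 ?addr_ge0 ?(abs_ge0 HW).
    - move=> i; rewrite /cons_coord; case: unliftP => [j _|_]; last first.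
        by rewrite abs0 // !addr_ge0 ?vnorm_ge0.
      by apply: le_trans (vnorm_ge w j) _; rewrite lerDr addr_ge0.
    - move=> i; rewrite /cons_coord; case: unliftP => [j _|_]; last first.
        by apply: le_trans s1 _; rewrite -addrA lerDl addr_ge0 ?vnorm_ge0.
      apply: le_trans (abs_triangle HW _ _) _; rewrite lerD ?vnorm_ge //.
      rewrite absM //; apply: (@le_trans _ _ (1 * rho)); last by rewrite mul1r lerDr.
      by rewrite ler_pM ?(abs_ge0 HW).
    move=> i; rewrite /cons_coord; case: unliftP => [j _|_]; last first.
      by rewrite sub0r absN // ler_peMr ?(abs_ge0 HW) // lerDl.
    rewrite opprD addrCA subrr addr0 absN // absM // ler_wpM2l ?(abs_ge0 HW) //.
    by apply: le_trans (hu j) _; rewrite lerDr.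
  by rewrite absV // mulrCA ler_pdivlMl.
have [T T0 HT] := bound 1 ler01.
exists (1 + (1 + T) * vnorm w) => P [z0 Pz0] Pp.
apply: contrapT => noz.
pose line (u : 'I_N -> F) : {poly F} := mmap polyC (fun i => (u i)%:P + w i *: 'X) P.
have lineE u t : (line u).[t] = meval (fun i => u i + t * w i) P.
  rewrite /line /mmap mevalE horner_sum; apply: eq_bigr => m _.
  rewrite hornerM hornerC; congr (_ * _); rewrite /mmap1 horner_prod; apply: eq_bigr => i _.
  by rewrite horner_exp !hornerE mulrC.
have cst e l t : meval (fun i => (pi ^+ l) ^+ e i + t * w i) P = meval (fun i => (pi ^+ l) ^+ e i) P.
  set u := fun i : 'I_N => (pi ^+ l) ^+ e i.
  have hu i : W (u i) <= 1 by rewrite !absX // -exprM exprn_ile1 // ltW.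
  have [/size_poly1P[c c0 lc]|/closed_rootP[x /eqP]] := boolP (size (line u) == 1)%N.
    rewrite -lineE lc hornerC -(hornerC c 0) -lc lineE; apply: meval_eq => i.
    by rewrite mul0r addr0.
  rewrite lineE => Px; case: noz; exists (fun i => u i + x * w i) => //.
  have xT : W x <= 1 + T.
    have [x1|/ltW x1] := leP 1 (W x); last by apply: le_trans x1 _; rewrite lerDl.
    apply: le_trans (_ : T <= _); last by rewrite lerDr.
    by apply: HT (Pp _ Px).
  apply: vnorm_le => [|i]; first by rewrite addr_ge0 // mulr_ge0 ?vnorm_ge0 ?addr_ge0.
  apply: le_trans (abs_triangle HW _ _) _; rewrite lerD // absM //.
  by rewrite ler_pM ?(abs_ge0 HW) ?vnorm_ge.
have invariant t : meval (fun i => z0 i + t * w i) P = 0.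
  pose Q := comp_mpoly [tuple mpolyX F (mnm1 i) + mpolyC N (t * w i) | i < N] P - P.
  have QE z : meval z Q = meval (fun i => z i + t * w i) P - meval z P.
    rewrite mevalB comp_mpoly_meval; congr (_ - _); apply: meval_eq => i.
    by rewrite tnth_mktuple mevalD mevalXU mevalC.
  have Q0 : Q = 0.
    apply/eqP; apply: contrapT => /negP /(mpoly_nonvanishing exp_small_inj)[e [l]].
    by rewrite QE cst subrr eqxx.
  by have := QE z0; rewrite Q0 meval0 Pz0 subr0.
have [K K0 HK] := bound (vnorm z0) (vnorm_ge0 _).
have [n hn] := @exprn_unbounded R (W pi)^-1 K (eqbRL (invf_gt1 pi_gt0) pi_lt1).
have WE : W (pi^-1 ^+ n) = (W pi)^-1 ^+ n by rewrite absX // absV.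
have : W (pi^-1 ^+ n) <= K.
  apply: (HK z0) (vnorm_ge z0) _ _; last exact: Pp.
  by rewrite WE exprn_ege1 // ltW // invf_gt1.
by rewrite WE leNgt hn.
Qed.
End Local.

(** * Escape of the critical hyperplanes *)

(** The hyperplanes x_j = 0 are critical, since the j-th column of the Jacobian
    matrix consists of multiples of x_j^(d-1); p is the product of the equations
    of the hypersurfaces whose union is the post-critical locus. *)
Lemma pcf_vanishing (F : closedFieldType) N d (A : 'M[F]_N) (b : 'cV[F]_N) :
  (2 <= d)%N -> PCF (power_affine_map d A b) ->
  exists (p : mpoly N.+1 F) (D : nat), [/\ p != 0,
    forall c x, meval (fun i => c * x i) p = c ^+ D * meval x p &
    forall n j x, x j = 0 ->
      meval (cons_coord 1 (iter n.+1 (affine_power_fun d A b) x)) p = 0].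
Proof.
move=> d2 [m [H [hypH locE]]].
have [k hk] := choice hypH; have [q hq] := choice hk.
have mapE x i : meval (cons_coord 1 x) (power_affine_map d A b i) =
    cons_coord 1 (affine_power_fun d A b x) i.
  rewrite /power_affine_map {2}/cons_coord; case: unliftP => [l _|_]; last first.
    by rewrite rmorphXn /= mevalXU /cons_coord unlift_none expr1n.
  rewrite rmorphD rmorph_sum /= mevalZ rmorphXn /= mevalXU /cons_coord unlift_none expr1n mulr1.
  by congr (_ + _); apply: eq_bigr => j _; rewrite mevalZ rmorphXn /= mevalXU liftK.
exists (\prod_i q i), (\sum_i k i)%N; split.
- by apply/prodf_neq0 => i _; have [] := hq i.
- move=> c x; rewrite !rmorph_prod /= -prodrXr -big_split /=; apply: eq_bigr => i _.
  by apply: homog_mevalZ; have [] := hq i.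
move=> n j x xj.
suff: postcritical_locus (power_affine_map d A b) (cons_coord 1 (iter n.+1 (affine_power_fun d A b) x)).
  rewrite locE => -[i _]; have [_ _ _ ->] := hq i => -[_ qi].
  by rewrite rmorph_prod /= (bigD1 i) //= qi mul0r.
exists n.+1 => //; elim: n.+1 => [|l IHl] /=; last first.
  exists (cons_coord 1 (iter l (affine_power_fun d A b) x)), 1; split => //; first exact: oner_neq0.
  by move=> i; rewrite mul1r mapE.
split; first by exists ord0; rewrite /cons_coord unlift_none oner_neq0.
rewrite /jacobian_det -det_map_mx (expand_det_col _ (lift ord0 j)) big1 // => i _.
rewrite !mxE; apply/eqP; rewrite mulf_eq0; apply/orP; left; apply/eqP.
change (meval (cons_coord 1 x) (mderiv (lift ord0 j) (power_affine_map d A b i)) = 0).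
have derivX l : meval (cons_coord 1 x) (mderiv (lift ord0 j) (mpolyX F (mnm1 l) ^+ d)) =
    (l == lift ord0 j)%:R * (x j ^+ d.-1) *+ d.
  rewrite mpolyXn mderivX mevalZ mevalX mulmnE mnm1E.
  have [->|_] := eqVneq l; last by rewrite mul0n !mul0r mul0rn.
  rewrite mul1n mul1r -[RHS]mulr_natl; congr (_ * _).
  rewrite (bigD1 (lift ord0 j)) //= big1 ?mulr1 => [|i' ne].
    by rewrite mnmBE mulmnE mnm1E eqxx /cons_coord liftK mul1n subn1.
  by rewrite mnmBE mulmnE mnm1E eq_sym (negbTE ne) mul0n expr0.
have zero_d : x j ^+ d.-1 = 0 by rewrite xj expr0n; case: (d) d2 => [|[]].
rewrite /power_affine_map; case: unliftP => [l _|_].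
  rewrite raddfD raddf_sum /= raddfD raddf_sum /= big1 => [|i' _].
    by rewrite add0r mderivZ mevalZ derivX zero_d mulr0 mul0rn mulr0.
  by rewrite mderivZ mevalZ derivX zero_d mulr0 mul0rn mulr0.
by rewrite derivX zero_d mulr0 mul0rn.
Qed.

Lemma escape_exponents N d e : (e <= d)%N ->
  (3 + 2 * e <= 3 * d + 3)%N /\ (N + N.+1 * e <= N.+1 * d.+1)%N.
Proof.
move=> le; split; first by rewrite addnC leq_add2r leq_mul.
by rewrite mulnSr addnC leq_add ?leq_mul.
Qed.

(** The constant kappa stands for the number of terms of a sum at an archimedean
    place and is 1 at a nonarchimedean one; max (2, N!) terms suffice for sums of
    two elements, products of matrices and determinants of size at most N. *)
Section LocalBound.
Variables (R : realType) (F : closedFieldType) (W : F -> R) (pi z : F) (N d : nat) (kappa : R).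
Hypotheses (HW : is_abs W) (pi_gt0 : 0 < W pi) (pi_lt1 : W pi < 1).
Hypotheses (zP : d.-primitive_root z) (d2 : (2 <= d)%N) (N1 : (1 <= N)%N) (kappa1 : 1 <= kappa).
Hypothesis sumW : forall (I : finType) (f : I -> F) M, (#|I| <= maxn 2 N`!)%N -> 0 <= M ->
  (forall i, W (f i) <= M) -> W (\sum_i f i) <= kappa * M.

Let kappa_ge0 : 0 <= kappa := le_trans ler01 kappa1.
Local Notation vnorm := (vnorm W).

Lemma abs_add_le x y M : 0 <= M -> W x <= M -> W y <= M -> W (x + y) <= kappa * M.
Proof.
move=> M0 hx hy; have := @sumW bool (fun c => if c then x else y) M.
rewrite card_bool leq_maxl big_bool /=; apply => // -[] //.
Qed.

Lemma abs_det_le n (A : 'M[F]_n) a : (n <= N)%N -> 0 <= a -> (forall i j, W (A i j) <= a) ->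
  W (\det A) <= kappa * a ^+ n.
Proof.
move=> nN a0 Aa; apply: sumW; rewrite ?exprn_ge0 //.
  by rewrite perm.card_Sn leq_max leq_fact ?orbT.
move=> s; rewrite absM // absX // absN // abs1 // expr1n mul1r abs_prod //.
by rewrite -[n in a ^+ n]card_ord -prodr_const; apply: ler_prod => i _; rewrite abs_ge0 //=.
Qed.

Lemma vnorm_mulmx (A : 'M[F]_N) a x : 0 <= a -> (forall i j, W (A i j) <= a) ->
  vnorm (fun i => \sum_j A i j * x j) <= kappa * a * vnorm x.
Proof.
move=> a0 Aa; apply: vnorm_le; first by rewrite !mulr_ge0 ?vnorm_ge0.
move=> i; rewrite -mulrA; apply: sumW; rewrite ?mulr_ge0 ?vnorm_ge0 //.
  by rewrite card_ord leq_max; apply/orP; right; apply: fact_geq.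
by move=> j; rewrite absM // ler_pM ?(abs_ge0 HW) ?vnorm_ge.
Qed.

(** A matrix with small entries has a small determinant. *)
Lemma unimodular_entries_large (A : 'M[F]_N) a :
  \det A = 1 -> 0 <= a -> (forall i j, W (A i j) <= a) -> 1 <= kappa * a.
Proof.
move=> detA a0 Aa; have := abs_det_le (leqnn N) a0 Aa; rewrite detA abs1 // => le1.
rewrite leNgt; apply/negP => slt.
have alt : a < 1 by apply: le_lt_trans slt; rewrite ler_peMl.
have aN : a ^+ N <= a by rewrite -[leRHS]expr1; apply: ler_wiXn2l => //; exact: ltW.
have : 1 <= kappa * a by apply: le_trans le1 _; rewrite ler_wpM2l.
by rewrite leNgt slt.
Qed.

(** Below, r0 = beta / t bounds the points of g (H_j) from below ([first]), and
    [step] compares |x|^d = |A^-1 (g x - b)| with |g x| and |b|.  If beta exceeds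
    the bound then r0^d > C beta, so that |g x| dominates |b| as soon as
    |x| >= r0; g then multiplies the norm by at least lam = r0^(d-1) / C > 1.  The
    entries of A^-1 are cofactors of A, hence bounded by a'. *)
Lemma local_bound (A : 'M[F]_N) (b : 'cV[F]_N) a :
  \det A = 1 -> PCF (power_affine_map d A b) ->
  0 <= a -> (forall i j, W (A i j) <= a) ->
  forall i, W (b i 0) <= kappa ^+ (3 * d + 3) * (kappa * a) ^+ (N.+1 * d.+1).
Proof.
move=> detA pcf a0 Aa.
have uA : A \in unitmx by rewrite unitmxE detA unitr1.
set s := kappa * a; have s0 : 0 <= s by rewrite mulr_ge0.
have s1 : 1 <= s by exact: unimodular_entries_large detA a0 Aa.
have as_ : a <= s by rewrite ler_peMl.
set a' := kappa * s ^+ N.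
have a'0 : 0 <= a' by rewrite mulr_ge0 ?exprn_ge0.
have invA i j : W (invmx A i j) <= a'.
  rewrite /invmx uA detA invr1 scale1r mxE /cofactor absM // absX // absN // abs1 // expr1n mul1r.
  apply: le_trans (abs_det_le (leq_pred N) s0 _) _ => [k l|]; first by rewrite !mxE (le_trans (Aa _ _)).
  by rewrite ler_wpM2l // ler_weXn2l // leq_pred.
pose vb i := b i 0.
suff: vnorm vb <= kappa ^+ (3 * d + 3) * s ^+ (N.+1 * d.+1).
  by move=> h i; apply: le_trans h; exact: (vnorm_ge W vb).
rewrite leNgt; apply/negP => big.
set beta := vnorm vb in big.
(* m + 1 = d - 1 is positive, so beta <= beta^(d-1) for beta > 1. *)
have [m dE] : exists m, d = m.+2 by exists d.-2; case: (d) d2 => [|[]].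
have kX e : 1 <= kappa ^+ e by rewrite exprn_ege1.
have sX e : 1 <= s ^+ e by rewrite exprn_ege1.
have beta_gt1 : 1 < beta.
  by apply: le_lt_trans big; rewrite -[1]mulr1 ler_pM.
have beta_gt0 : 0 < beta by apply: lt_trans beta_gt1.
have beta_big e f : (e <= 3 * d + 3)%N -> (f <= N.+1 * d.+1)%N -> kappa ^+ e * s ^+ f < beta ^+ m.+1.
  move=> he hf; apply: lt_le_trans (_ : beta <= _); last first.
    by rewrite exprS ler_peMr ?exprn_ege1 // ltW.
  by apply: le_lt_trans big; rewrite ler_pM ?exprn_ge0 // ler_weXn2l.
set C := kappa ^+ 3 * s ^+ N.
have C0 : 0 < C by rewrite mulr_gt0 // (lt_le_trans ltr01).
set t := kappa ^+ 2 * s ^+ N.+1.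
have t0 : 0 < t by rewrite mulr_gt0 // (lt_le_trans ltr01).
set g := affine_power_fun d A b.
have invK x i : \sum_j invmx A i j * (\sum_k A j k * x k) = x i.
  by rewrite mulmx_funK ?mulVmx.
have Kinv x i : \sum_j A i j * (\sum_k invmx A j k * x k) = x i.
  by rewrite mulmx_funK ?mulmxV.
pose c i := \sum_j invmx A i j * vb j.
have [j cj] := vnorm_eq HW c (Ordinal N1).
have beta_c : beta <= s * vnorm c.
  apply: le_trans (vnorm_mulmx c a0 Aa).
  apply: vnorm_le => [|i]; rewrite ?vnorm_ge0 // -(Kinv vb i).
  exact: (vnorm_ge W (fun i => \sum_j A i j * c j)).
clearbody s.
have first x : x j = 0 -> beta / t <= vnorm (g x).
  move=> xj; rewrite ler_pdivrMr //; apply: le_trans beta_c _.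
  have -> : vnorm c = W (\sum_k invmx A j k * g x k).
    rewrite cj; congr (W _); rewrite /g /affine_power_fun.
    under [RHS]eq_bigr do rewrite mulrDr.
    rewrite big_split /= (invK (fun k => x k ^+ d)) xj expr0n.
    by rewrite dE add0r.
  apply: le_trans (_ : s * (kappa * a' * vnorm (g x)) <= _).
    rewrite ler_wpM2l //; apply: le_trans (vnorm_mulmx (g x) a'0 invA).
    exact: (vnorm_ge W (fun i => \sum_k invmx A i k * g x k)).
  by rewrite /t /a' exprS [s ^+ N.+1]exprS le_eqVlt; apply/orP; left; apply/eqP; ring.
have step x : vnorm x ^+ d <= C * Num.max (vnorm (g x)) beta.
  have [i ->] := vnorm_eq HW x (Ordinal N1); rewrite -absX //.
  set M := Num.max _ _; have M0 : 0 <= M by rewrite le_max vnorm_ge0.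
  rewrite -(invK (fun k => x k ^+ d) i).
  have -> : C * M = kappa * a' * (kappa * M) by rewrite /C /a'; ring.
  apply: le_trans (vnorm_ge W (fun i => \sum_j invmx A i j * (\sum_k A j k * x k ^+ d)) i) _.
  apply: le_trans (vnorm_mulmx _ a'0 invA) _; rewrite ler_wpM2l ?mulr_ge0 ?exprn_ge0 //.
  apply: vnorm_le => [|k]; first by rewrite mulr_ge0.
  rewrite -[X in W X](addrK (b k 0)); apply: abs_add_le => //.
    by rewrite le_max (vnorm_ge W (g x)).
  by rewrite absN // le_max (vnorm_ge W vb) orbT.
pose r0 := beta / t; pose lam := r0 ^+ m.+1 / C.
have r0_gt0 : 0 < r0 by rewrite divr_gt0.
have CtE e : C * t ^+ e = kappa ^+ (3 + 2 * e) * s ^+ (N + N.+1 * e).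
  rewrite /C /t [(_ * _) ^+ e]exprMn -(exprM kappa 2 e) -(exprM s N.+1 e) mulrACA.
  by rewrite -(exprD kappa) -(exprD s).
have lam1 : 1 < lam.
  rewrite /lam ltr_pdivlMr // mul1r /r0 expr_div_n ltr_pdivlMr ?exprn_gt0 // CtE.
  by have [] := @escape_exponents N d m.+1; [rewrite dE|exact: beta_big].
have r0d : C * beta < r0 ^+ d.
  rewrite /r0 expr_div_n ltr_pdivlMr ?exprn_gt0 // mulrAC CtE.
  rewrite [in beta ^+ d]dE [beta ^+ m.+2]exprSr (ltr_pM2r beta_gt0).
  by have [] := escape_exponents N (leqnn d); exact: beta_big.
have grow x : r0 <= vnorm x -> lam * vnorm x <= vnorm (g x).
  move=> hx; have := step x; rewrite maxEle; case: ifP => [_|_].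
    rewrite leNgt => /negP[]; apply: lt_le_trans r0d _.
    by rewrite lerXn2r // nnegrE ?vnorm_ge0 // ltW.
  move=> le; rewrite /lam mulrAC ler_pdivrMr // [leRHS]mulrC; apply: le_trans le.
  rewrite [in leRHS]dE [leRHS]exprSr ler_wpM2r ?vnorm_ge0 // lerXn2r // nnegrE ?vnorm_ge0 //.
  exact: ltW.
have escape n x : x j = 0 -> lam ^+ n * r0 <= vnorm (iter n.+1 g x).
  move=> xj; elim: n => [|n IHn]; first by rewrite expr0 mul1r; apply: first.
  have lam0 : 0 <= lam by apply: ltW; apply: lt_trans lam1.
  apply: le_trans (grow (iter n.+1 g x) _).
    by rewrite exprS -mulrA ler_wpM2l.
  by apply: le_trans IHn; rewrite ler_peMl ?exprn_ege1 // ltW.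
have [p [D [p0 hom_p vanish]]] := pcf_vanishing d2 pcf.
have [M HM] := trapped_zeros HW pi_gt0 pi_lt1 p0 hom_p.
have [n hn] := exprn_unbounded (M / r0) lam1.
have [P [_ Pz PP]] := iter_pushforward b j n.+1 zP (exp_small_inj HW pi_gt0 pi_lt1) uA.
have [|y Py yM] := HM P Pz; first by move=> y /PP[x xj ->]; apply: vanish xj.
have [x xj yE] := PP y Py.
have := le_trans (escape n x xj) (_ : _ <= M); rewrite -yE => /(_ yM).
by rewrite -ler_pdivlMr // leNgt hn.
Qed.
End LocalBound.

(** * Extending a nonarchimedean absolute value *)

Section Chevalley.
Variables (R : realType) (K F : fieldType) (iota : {rmorphism K -> F}) (v : K -> R) (varpi : K).
Hypotheses (Hv : is_abs v) (ultra_v : ultrametric v) (p_gt0 : 0 < v varpi) (p_lt1 : v varpi < 1).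
Hypothesis algF : forall x : F, exists2 f : {poly K}, f != 0 & root (map_poly iota f) x.

Let p := iota varpi.

(** The element p^-1 is excluded in order that p generate a proper ideal: this
    keeps the value of p below 1 in the extension. *)
Definition proper_ring_over (S : set F) := [/\ forall x y, S x -> S y -> S (x - y),
  forall x y, S x -> S y -> S (x * y), forall a, v a <= 1 -> S (iota a) & ~ S p^-1].

Lemma p_neq0 : p != 0.
Proof. by rewrite fmorph_eq0 -(abs_gt0 Hv). Qed.

Lemma proper_ring_base : proper_ring_over [set iota a | a in [set a | v a <= 1]].
Proof.
split.
- move=> _ _ [a /= va <-] [b /= vb <-]; exists (a - b); last by rewrite rmorphB.
  by apply: le_trans (ultra_v a (- b)) _; rewrite absN // ge_max va vb.
- move=> _ _ [a /= va <-] [b /= vb <-]; exists (a * b); last by rewrite rmorphM.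
  by rewrite /= absM // -[leRHS]mulr1 ler_pM ?(abs_ge0 Hv).
- by move=> a va; exists a.
case=> a /= va; rewrite /p -fmorphV => /fmorph_inj ap.
by move: va; rewrite ap absV // leNgt invf_gt1 // p_lt1.
Qed.

(** Zorn's lemma is applied to the family extended by the empty set, so that the
    union of the empty chain belongs to it. *)
Lemma maximal_proper_ring :
  exists2 V : set F, proper_ring_over V & forall S, proper_ring_over S -> V `<=` S -> S `<=` V.
Proof.
have [C CP|V [VP maxV]] := @Zorn_bigcup F (fun S => S = set0 \/ proper_ring_over S).
  move=> tot; have [[S0 CS0 g0]|noC] := pselect (exists2 S, C S & proper_ring_over S); last first.
    left; rewrite -subset0 => x [S CS Sx]; have [S0|gS] := CP S CS; first by rewrite S0 in Sx.
    by case: noC; exists S.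
  have join x y : (\bigcup_(X in C) X) x -> (\bigcup_(X in C) X) y ->
      exists S, [/\ C S, proper_ring_over S, S x & S y].
    move=> [S CS Sx] [T CT Ty].
    have gS : proper_ring_over S by case: (CP S CS) => // E; rewrite E in Sx.
    have gT : proper_ring_over T by case: (CP T CT) => // E; rewrite E in Ty.
    by have [ST|TS] := tot S T CS CT; [exists T|exists S]; split => //; [apply: ST|apply: TS].
  right; split.
  - by move=> x y hx hy; have [S [CS [gB _ _ _] Sx Sy]] := join x y hx hy; exists S => //; apply: gB.
  - by move=> x y hx hy; have [S [CS [_ gM _ _] Sx Sy]] := join x y hx hy; exists S => //; apply: gM.
  - by move=> a va; exists S0 => //; have [_ _ + _] := g0; apply.
  by move=> h; have [S [_ [_ _ _ gp] Sp _]] := join _ _ h h.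
have gV : proper_ring_over V.
  case: VP => // V_0; exfalso.
  apply: (maxV [set iota a | a in [set a | v a <= 1]]); last by right; exact: proper_ring_base.
  split=> [x|/(_ (iota 0))]; rewrite V_0 //; apply; exists 0 => //=.
  by rewrite abs0 // ler01.
exists V => // S gS VS; apply: contrapT => nSV.
by apply: (maxV S); [split|right].
Qed.

Section ValuationRing.
Variable V : set F.
Hypotheses (gV : proper_ring_over V) (maxV : forall S, proper_ring_over S -> V `<=` S -> S `<=` V).

Lemma V_sub x y : V x -> V y -> V (x - y). Proof. by have [+ _ _ _] := gV; apply. Qed.
Lemma V_mul x y : V x -> V y -> V (x * y). Proof. by have [_ + _ _] := gV; apply. Qed.
Lemma V_iota a : v a <= 1 -> V (iota a). Proof. by have [_ _ + _] := gV; apply. Qed.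
Lemma V_inv_p : ~ V p^-1. Proof. by have [] := gV. Qed.
Lemma V_0 : V 0. Proof. by rewrite -(rmorph0 iota); apply: V_iota; rewrite abs0 ?ler01. Qed.
Lemma V_1 : V 1. Proof. by rewrite -(rmorph1 iota); apply: V_iota; rewrite abs1. Qed.
Lemma V_opp x : V x -> V (- x). Proof. by rewrite -sub0r; apply: V_sub V_0. Qed.
Lemma V_add x y : V x -> V y -> V (x + y).
Proof. by move=> Vx Vy; rewrite -[y]opprK; apply: V_sub (V_opp Vy). Qed.
Lemma V_exp x n : V x -> V (x ^+ n).
Proof. by move=> Vx; elim: n => [|n IHn]; rewrite ?expr0 ?exprS; [apply: V_1|apply: V_mul]. Qed.
Lemma V_sum I (r : seq I) (P : pred I) (f : I -> F) :
  (forall i, P i -> V (f i)) -> V (\sum_(i <- r | P i) f i).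
Proof. by move=> Vf; elim/big_ind: _ => //; [apply: V_0|apply: V_add]. Qed.
Lemma V_p : V p. Proof. by apply: V_iota; rewrite ltW. Qed.

(** If v a > 1, some power of a has a value above that of p^-1, so that a cannot
    be in V along with the unit ball of v. *)
Lemma V_iota_le1 a : V (iota a) -> v a <= 1.
Proof.
move=> Va; rewrite leNgt; apply/negP => va.
have [n hn] := exprn_unbounded (v varpi)^-1 va.
apply: V_inv_p; have a0 : iota a != 0 by rewrite fmorph_eq0 -(abs_gt0 Hv) (lt_trans ltr01).
have -> : p^-1 = iota (varpi^-1 / a ^+ n) * iota a ^+ n.
  by rewrite rmorphM fmorphV /= fmorphV rmorphXn /= mulfVK ?expf_neq0.
apply: V_mul (V_exp n Va); apply: V_iota.
rewrite absf // absV // absX // ler_pdivrMr ?exprn_gt0 ?(lt_trans ltr01) //.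
by rewrite mul1r ltW.
Qed.

(** For x outside V, the ring V[x] is larger than V, so it contains p^-1. *)
Lemma adjoin_inverts x : ~ V x -> exists2 q : {poly F}, (forall i, V q`_i) & p * q.[x] = 1.
Proof.
move=> nVx; apply: contrapT => noq; apply: nVx.
pose S := [set y | exists2 q : {poly F}, (forall i, V q`_i) & q.[x] = y].
have gS : proper_ring_over S.
  split.
  - move=> _ _ [q Vq <-] [r Vr <-]; exists (q - r); last by rewrite hornerD hornerN.
    by move=> i; rewrite coefB; apply: V_sub.
  - move=> _ _ [q Vq <-] [r Vr <-]; exists (q * r); last by rewrite hornerM.
    by move=> i; rewrite coefM; apply: V_sum => j _; apply: V_mul.
  - move=> a va; exists (iota a)%:P; last by rewrite hornerC.
    by move=> i; rewrite coefC; case: eqP => _; [apply: V_iota|apply: V_0].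
  case=> q Vq qx; apply: noq; exists q => //; by rewrite qx mulfV ?p_neq0.
apply: (maxV gS) => [y Vy|].
  exists y%:P; last by rewrite hornerC.
  by move=> i; rewrite coefC; case: eqP => _ //; apply: V_0.
exists 'X; last by rewrite hornerX.
by move=> i; rewrite coefX; case: eqP => _; [apply: V_1|apply: V_0].
Qed.

(** p lies in the Jacobson radical of V: if u = 1 - p a had no inverse in V, an
    equation 1 = p q(1/u) multiplied by a power u^n, congruent to 1 modulo p,
    would make p invertible. *)
Lemma one_sub_unit a : V a -> 1 - p * a != 0 /\ V (1 - p * a)^-1.
Proof.
move=> Va; have u0 : 1 - p * a != 0.
  apply/eqP => /eqP; rewrite subr_eq0 => /eqP pa; apply: V_inv_p.
  by rewrite -[p^-1]mulr1 pa mulKf ?p_neq0.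
split=> //; apply: contrapT => /adjoin_inverts[q Vq]; set u := 1 - _ in u0 * => pq.
have Vu : V u by apply: V_sub V_1 (V_mul V_p Va).
pose n := size q.
have un : exists2 c, V c & u ^+ n = 1 - p * c.
  elim: n => [|n [c Vc un]]; first by exists 0; [apply: V_0|rewrite mulr0 subr0].
  exists (a + c - p * a * c); last by rewrite exprS un /u; ring.
  by apply: V_sub; [apply: V_add|apply: V_mul => //; apply: V_mul V_p Va].
have [c Vc uc] := un; apply: V_inv_p.
have -> : p^-1 = \sum_(i < n) q`_i * u ^+ (n - i) + c.
  apply: (mulfI p_neq0); rewrite mulfV ?p_neq0 // mulrDr.
  have -> : \sum_(i < n) q`_i * u ^+ (n - i) = u ^+ n * q.[u^-1].
    rewrite horner_coef mulr_sumr; apply: eq_bigr => i _.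
    by rewrite mulrCA exprVn -expfB.
  by rewrite mulrCA pq mulr1 uc subrK.
by apply: V_add => //; apply: V_sum => i _; apply: V_mul => //; apply: V_exp.
Qed.

(** If neither x nor 1/x is in V, take q and r of least degrees n and m with
    p q(x) = 1 = p r(1/x), and say m <= n.  As 1 - p r_0 is a unit, the second
    equation expresses x^n by lower powers of x; substituting this into the
    leading term of q lowers its degree, a contradiction. *)
Lemma valuation_ring x : x != 0 -> V x \/ V x^-1.
Proof.
move=> x0; apply: contrapT => /not_orP[nx nxV].
pose rep (y : F) n := exists q : {poly F}, [/\ forall i, V q`_i, p * q.[y] = 1 & (size q <= n.+1)%N].
have min_rep y : ~ V y -> exists n, rep y n /\ forall m, rep y m -> (n <= m)%N.
  move=> /adjoin_inverts[q Vq pq].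
  have ex : exists n, `[< rep y n >] by exists (size q); apply/asboolP; exists q.
  have [n /asboolP hn min] := ex_minnP ex; exists n; split => // m hm.
  by apply: min; apply/asboolP.
have [n [hn minn]] := min_rep _ nx; have [m [hm minm]] := min_rep _ nxV.
have reduce y n' m' : y != 0 -> rep y n' -> (forall k, rep y k -> (n' <= k)%N) -> rep y^-1 m' ->
    (m' <= n')%N -> False.
  move=> y0 [q [Vq pq sq]] min [r [Vr pr sr]] le.
  have [u0 Vu] := one_sub_unit (Vr 0%N); set u := 1 - _ in u0 Vu.
  case: n' sq min le => [|n'] sq min le.
    move: sr le; case: m' => // sr _; move: pr u0.
    by rewrite (horner_coef_wide _ sr) big_ord1 expr0 mulr1 /u => ->; rewrite subrr eqxx.
  suff /min : rep y n' by rewrite ltnn.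
  exists (\poly_(i < n'.+1) (q`_i + q`_n'.+1 * u^-1 * p * r`_(n'.+1 - i))); split.
  - move=> i; rewrite coef_poly; case: ifP => _; last exact: V_0.
    by apply: V_add => //; apply: V_mul (Vr _); apply: V_mul V_p; exact: V_mul.
  - rewrite -pq; congr (_ * _).
    rewrite horner_poly (horner_coef_wide _ sq) [RHS]big_ord_recr /=.
    under eq_bigr do rewrite mulrDl -mulrA.
    rewrite big_split /= -mulr_sumr; congr (_ + _).
    have split_pow e f g : (e + f = g)%N -> y ^+ e = y ^+ g * y^-1 ^+ f.
      by move=> <-; rewrite exprD exprVn mulfK ?expf_neq0.
    have sr' : (size r <= n'.+2)%N by apply: leq_trans sr _; rewrite ltnS.
    have rev : \sum_(i < n'.+1) r`_(n'.+1 - i) * y ^+ i = y ^+ n'.+1 * (r.[y^-1] - r`_0).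
      rewrite (horner_coef_wide _ sr') [in RHS]big_ord_recl expr0 mulr1 addrAC subrr add0r mulr_sumr.
      rewrite (reindex_inj rev_ord_inj); apply: eq_bigr => i _ /=.
      have lei : (i <= n')%N by have := ltn_ord i; rewrite ltnS.
      rewrite subSS (subSn (leq_subr _ _)) (subKn lei).
      rewrite [RHS]mulrCA /bump leq0n add1n; congr (_ * _).
      by apply: split_pow; rewrite addnS subnK.
    rewrite rev mulrBr; have -> : y ^+ n'.+1 * r.[y^-1] = y ^+ n'.+1 / p.
      by congr (_ * _); apply: (mulfI p_neq0); rewrite pr mulfV ?p_neq0.
    by move: u0; rewrite /u => u1; field; rewrite p_neq0 u1.
  exact: size_poly.
have [le|/ltnW le] := leqP m n; first exact: (reduce x n m).
by apply: (reduce x^-1 m n) => //; rewrite ?invr_eq0 ?invrK.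
Qed.


(** Two elements are associate when they have the same value. *)
Definition assoc x y := V (x / y) /\ V (y / x).

Lemma assocM x y x' y' : assoc x y -> assoc x' y' -> assoc (x * x') (y * y').
Proof. by move=> [h1 h2] [h3 h4]; split; rewrite invfM mulrACA; apply: V_mul. Qed.

Lemma assocX x y n : assoc x y -> assoc (x ^+ n) (y ^+ n).
Proof. by move=> [h1 h2]; split; rewrite -expr_div_n; apply: V_exp. Qed.

Lemma assoc_iota a b : a != 0 -> b != 0 -> assoc (iota a) (iota b) -> v a = v b.
Proof.
move=> a0 b0 []; rewrite -!fmorphV -!rmorphM => /V_iota_le1 + /V_iota_le1.
rewrite !absf // !ler_pdivrMr ?abs_gt0 // !mul1r => h1 h2.
by apply/eqP; rewrite eq_le h1 h2.
Qed.

(** When y / z is in V, an inverse of y + z in V would give one of z, because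
    1/z = (1 + y/z) / (y + z). *)
Lemma nonunit_sum y z : V y -> V z -> ~ V y^-1 -> ~ V z^-1 -> y + z != 0 -> ~ V (y + z)^-1.
Proof.
wlog h : y z / V (y / z).
  move=> wl Vy Vz ny nz yz.
  have [z0|z0] := eqVneq z 0; first by move: nz; rewrite z0 invr0 => -[]; apply: V_0.
  have [y0|y0] := eqVneq y 0; first by move: ny; rewrite y0 invr0 => -[]; apply: V_0.
  have [|h|h] := @valuation_ring (y / z); first by rewrite mulf_neq0 ?invr_eq0.
    exact: wl.
  by rewrite addrC; apply: wl => //; [rewrite -invf_div|rewrite addrC].
move=> Vy Vz ny nz yz Vyz; apply: nz.
have [z0|z0] := eqVneq z 0; first by rewrite z0 invr0; apply: V_0.
have -> : z^-1 = (1 + y / z) * (y + z)^-1 by field; rewrite z0 yz.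
by apply: V_mul => //; apply: V_add => //; apply: V_1.
Qed.

Lemma max_term n (t : nat -> F) : (exists2 i, (i < n)%N & t i != 0) ->
  exists i, [/\ (i < n)%N, t i != 0 & forall j, (j < n)%N -> V (t j / t i)].
Proof.
elim: n => [[//]|n IHn] [i0 ltin ti0].
have [ex|none] := pselect (exists2 i, (i < n)%N & t i != 0); last first.
  have zero j : (j < n)%N -> t j = 0.
    by move=> lt; apply/eqP; apply: contrapT => /negP tj; apply: none; exists j.
  have i0n : i0 = n.
    move: ltin; rewrite ltnS leq_eqVlt => /orP[/eqP //|lt].
    by case: none; exists i0.
  rewrite i0n in ti0; exists n; split=> [|//|j]; first exact: ltnSn.
  rewrite ltnS leq_eqVlt => /orP[/eqP ->|/zero ->]; first by rewrite mulfV //; apply: V_1.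
  by rewrite mul0r; apply: V_0.
have [i [lti ti hi]] := IHn ex.
have [tn|tn] := eqVneq (t n) 0.
  exists i; split=> [|//|j]; first exact: ltnW.
  rewrite ltnS leq_eqVlt => /orP[/eqP ->|/hi //].
  by rewrite tn mul0r; apply: V_0.
have [|h|h] := @valuation_ring (t n / t i); first by rewrite mulf_neq0 ?invr_eq0.
  exists i; split=> [|//|j]; first exact: ltnW.
  by rewrite ltnS leq_eqVlt => /orP[/eqP ->|/hi].
exists n; split=> // j; rewrite ltnS leq_eqVlt => /orP[/eqP ->|/hi hj].
  by rewrite mulfV //; apply: V_1.
have -> : t j / t n = (t j / t i) * (t n / t i)^-1 by field; rewrite ti tn.
exact: V_mul.
Qed.

(** In an algebraic equation satisfied by x, the term of largest value cannot be
    the only one with this value, and comparing two such terms gives the value of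
    a power of x. *)
Lemma value_group_torsion x : x != 0 ->
  exists m k, [/\ (0 < m)%N, k != 0 & assoc (x ^+ m) (iota k)].
Proof.
move=> x0; have [f f0 fx] := algF x.
pose t i := iota f`_i * x ^+ i.
have sum0 : \sum_(i < size f) t i = 0.
  transitivity (map_poly iota f).[x]; last exact/eqP.
  rewrite horner_coef size_map_poly.
  by apply: eq_bigr => i _; rewrite coef_map.
have [|i [lti ti hi]] := @max_term (size f) t.
  exists (size f).-1; first by rewrite prednK ?lt0n ?size_poly_eq0.
  by rewrite mulf_neq0 ?expf_neq0 // fmorph_eq0 -lead_coefE lead_coef_eq0.
have two_terms a b : (a < b)%N -> t a != 0 -> t b != 0 -> V (t a / t b) -> V (t b / t a) ->
    exists m k, [/\ (0 < m)%N, k != 0 & assoc (x ^+ m) (iota k)].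
  move=> ltab ta tb h1 h2.
  have fa : f`_a != 0 by apply: contra_neq ta => E; rewrite /t E rmorph0 mul0r.
  have fb : f`_b != 0 by apply: contra_neq tb => E; rewrite /t E rmorph0 mul0r.
  have fa' : iota f`_a != 0 by rewrite fmorph_eq0.
  have fb' : iota f`_b != 0 by rewrite fmorph_eq0.
  exists (b - a)%N, (f`_a / f`_b); split; first by rewrite subn_gt0.
    by rewrite mulf_neq0 ?invr_eq0.
  have xa : x ^+ a != 0 by rewrite expf_neq0.
  have xb : x ^+ b != 0 by rewrite expf_neq0.
  rewrite /assoc expfB // rmorphM fmorphV /=.
  have -> : x ^+ b / x ^+ a / (iota f`_a / iota f`_b) = t b / t a.
    by rewrite /t; field; rewrite fa' fb' xa.
  have -> // : iota f`_a / iota f`_b / (x ^+ b / x ^+ a) = t a / t b.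
  by rewrite /t; field; rewrite fb' xb xa.
have [[j [ltj ne tj hj]]|none] :=
    pselect (exists j, [/\ (j < size f)%N, j != i, t j != 0 & V (t i / t j)]).
  case: (ltngtP i j) => [lt|lt|eq]; last by rewrite eq eqxx in ne.
    by apply: (two_terms i j) => //; apply: hi.
  by apply: (two_terms j i) => //; apply: hi.
exfalso.
pose small y := y = 0 \/ V y /\ ~ V y^-1.
have smallD y z : small y -> small z -> small (y + z).
  move=> [->|[Vy ny]]; first by rewrite add0r.
  move=> [->|[Vz nz]]; first by rewrite addr0; right.
  have [->|yz] := eqVneq (y + z) 0; [by left|right].
  by split; [apply: V_add|apply: nonunit_sum].
have : small (\sum_(j < size f | j != Ordinal lti) t j / t i).
  elim/big_ind: _ => [||j ne]; [by left|exact: smallD|].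
  have [tj|tj] := eqVneq (t j) 0; first by left; rewrite tj mul0r.
  right; split; first exact: hi.
  by rewrite invf_div => h; apply: none; exists j.
have -> : \sum_(j < size f | j != Ordinal lti) t j / t i = -1.
  rewrite -mulr_suml; apply: (mulIf ti); rewrite mulfVK // mulN1r.
  by have := sum0; rewrite (bigD1 (Ordinal lti)) //= => /eqP; rewrite addrC addr_eq0 => /eqP.
case=> [/eqP|[_ []]]; first by rewrite oppr_eq0 oner_eq0.
by rewrite invrN1; apply/V_opp/V_1.
Qed.

(** The value that multiplicativity imposes on x: the m-th root of v k when x^m
    and k have the same value. *)
Definition rank_value x w :=
  exists m k, [/\ (0 < m)%N, k != 0, assoc (x ^+ m) (iota k) & w = expR (ln (v k) / m%:R)].

Lemma rank_value_uniq x w w' : x != 0 -> rank_value x w -> rank_value x w' -> w = w'.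
Proof.
move=> x0 [m [k [m0 k0 h ->]]] [m' [k' [m'0 k'0 h' ->]]]; congr expR.
have : assoc (iota (k ^+ m')) (iota (k' ^+ m)).
  rewrite !rmorphXn; have [a1 a2] := assocX m' h; have [b1 b2] := assocX m h'.
  rewrite -!exprM mulnC in a1 a2 b1 b2; rewrite [(m' * m)%N]mulnC in b1 b2.
  have xn : x ^+ (m * m') != 0 by rewrite expf_neq0.
  have kn : iota k ^+ m' != 0 by rewrite expf_neq0 ?fmorph_eq0.
  have kn' : iota k' ^+ m != 0 by rewrite expf_neq0 ?fmorph_eq0.
  split.
    have -> : iota k ^+ m' / iota k' ^+ m =
        (iota k ^+ m' / x ^+ (m * m')) * (x ^+ (m * m') / iota k' ^+ m).
      by field; rewrite xn kn'.
    by apply: V_mul => //; rewrite mulnC.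
  have -> : iota k' ^+ m / iota k ^+ m' =
      (iota k' ^+ m / x ^+ (m * m')) * (x ^+ (m * m') / iota k ^+ m').
    by field; rewrite xn kn.
  by apply: V_mul => //; rewrite mulnC.
move=> /assoc_iota; rewrite !expf_neq0 // => /(_ isT isT); rewrite !absX // => E.
have := congr1 (@ln R) E; rewrite !lnXn ?abs_gt0 // => {}E.
by apply/eqP; rewrite eqr_div ?pnatr_eq0 -?lt0n // !mulr_natr E.
Qed.

Lemma chevalley_extension :
  exists W : F -> R, [/\ is_abs W, ultrametric W & forall a, W (iota a) = v a].
Proof.
have exW x : exists w, (x = 0 -> w = 0) /\ (x != 0 -> rank_value x w).
  have [->|x0] := eqVneq x 0; first by exists 0.
  have [m [k [m0 k0 h]]] := value_group_torsion x0.
  by exists (expR (ln (v k) / m%:R)); split=> [E|_]; [rewrite E eqxx in x0|exists m, k].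
have [W WP] := choice exW.
have W0 : W 0 = 0 by case: (WP 0) => + _; apply.
have Wn0 x : x != 0 -> 0 < W x.
  by move=> x0; have [_ /(_ x0) [m [k [_ _ _ ->]]]] := WP x; exact: expR_gt0.
have W_uniq x w : x != 0 -> rank_value x w -> W x = w.
  by move=> x0; apply: rank_value_uniq => //; have [_ /(_ x0)] := WP x.
have W_ge0 x : 0 <= W x by have [->|/Wn0/ltW] := eqVneq x 0; rewrite ?W0.
have WM x y : W (x * y) = W x * W y.
  have [->|x0] := eqVneq x 0; first by rewrite !mul0r W0 mul0r.
  have [->|y0] := eqVneq y 0; first by rewrite !mulr0 W0 mulr0.
  have [_ /(_ x0) [m [k [m0 k0 h ->]]]] := WP x; have [_ /(_ y0) [n [l [n0 l0 g ->]]]] := WP y.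
  apply: W_uniq; first by rewrite mulf_neq0.
  exists (m * n)%N, (k ^+ n * l ^+ m); split; rewrite ?muln_gt0 ?m0 ?mulf_neq0 ?expf_neq0 //.
    rewrite exprMn rmorphM !rmorphXn exprM [in y ^+ _]mulnC exprM.
    by apply: assocM; apply: assocX.
  rewrite -expRD (absM Hv) !(absX Hv) lnM ?posrE ?exprn_gt0 ?(abs_gt0 Hv) //.
  rewrite !lnXn ?(abs_gt0 Hv) //.
  congr expR; have mR : m%:R != 0 :> R by rewrite pnatr_eq0 -lt0n.
  have nR : n%:R != 0 :> R by rewrite pnatr_eq0 -lt0n.
  rewrite natrM mulrDl -!(mulr_natr (ln _)); congr (_ + _).
    by rewrite [m%:R * _]mulrC invfM mulrA mulfK.
  by rewrite invfM mulrA mulfK.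
have W_le1 x : W x <= 1 <-> V x.
  have [->|x0] := eqVneq x 0; first by rewrite W0 ler01; split => // _; apply: V_0.
  have [_ /(_ x0) [m [k [m0 k0 [h1 h2] ->]]]] := WP x.
  have xm : x ^+ m != 0 by rewrite expf_neq0.
  have k' : iota k != 0 by rewrite fmorph_eq0.
  have vk : 0 < v k by rewrite abs_gt0.
  have -> : (expR (ln (v k) / m%:R) <= 1) = (v k <= 1).
    rewrite -[X in _ <= X]expR0 ler_expR pmulr_lle0 ?invr_gt0 ?ltr0n //.
    by rewrite -[X in _ <= X]ln1 ler_ln ?posrE.
  split=> [vk1|Vx]; last first.
    by apply: V_iota_le1; rewrite -(divfK xm (iota k)); apply: V_mul => //; apply: V_exp.
  have Vxm : V (x ^+ m) by rewrite -(divfK k' (x ^+ m)); apply: V_mul => //; apply: V_iota.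
  have [//|VV] := valuation_ring x0.
  have -> : x = x ^+ m * x^-1 ^+ m.-1.
    by rewrite -{1}(prednK m0) exprS exprVn mulfK ?expf_neq0.
  by apply: V_mul => //; apply: V_exp.
have ultra_W : ultrametric W.
  have le_case x y : W x <= W y -> W (x + y) <= W y.
    move=> le; have [y0|y0] := eqVneq y 0.
      by rewrite y0 addr0 -y0.
    have -> : x + y = (x / y + 1) * y by rewrite mulrDl mul1r divfK.
    rewrite WM -[leRHS]mul1r ler_wpM2r //; apply/W_le1/V_add; last exact: V_1.
    apply/W_le1; have : W (x / y) * W y <= W y by rewrite -WM divfK.
    by rewrite -[leRHS]mul1r ler_pM2r ?Wn0.
  move=> x y; have [le|/ltW le] := leP (W x) (W y); first exact: le_case.
  by rewrite addrC; apply: le_case.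
exists W; split=> [|//|a].
  split=> // [x|x y].
    split=> [Wx|->] //; apply/eqP; apply: contrapT => /negP /Wn0.
    by rewrite Wx ltxx.
  by apply: le_trans (ultra_W x y) _; rewrite ge_max lerDl lerDr !W_ge0.
have [->|a0] := eqVneq a 0; first by rewrite rmorph0 W0 abs0.
apply: W_uniq; first by rewrite fmorph_eq0.
exists 1%N, a; split=> //; last by rewrite divr1 lnK // posrE abs_gt0.
by rewrite expr1 /assoc mulfV ?fmorph_eq0 //; split; apply: V_1.
Qed.

End ValuationRing.

(** Chevalley's extension theorem, in the case of rank one. *)
Lemma nonarchimedean_extension :
  exists W : F -> R, [/\ is_abs W, ultrametric W & forall a, W (iota a) = v a].
Proof. by have [V gV maxV] := maximal_proper_ring; exact: (chevalley_extension gV maxV). Qed.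

End Chevalley.

(** * Automorphisms and the usual absolute value of algebraic numbers *)

Lemma rmorph_in_alg (K : fieldExtType rat) (iota : {rmorphism K -> algC}) :
  iota \o in_alg K =1 ratr.
Proof. by move=> q /=; rewrite alg_num_field fmorph_rat. Qed.

(** The roots of the minimal polynomial of x generate a normal number field; an
    automorphism of this field that sends x to y extends to algC. *)
Lemma conjugate_by_automorphism (x y : algC) : root (minCpoly x) y ->
  exists nu : {rmorphism algC -> algC}, nu x = y.
Proof.
move=> xy; have [p0 [p0E mon_p0] dvd_p0] := minCpolyP x.
have [r Dr] := closed_field_poly_normal (minCpoly x).
rewrite (monicP (minCpoly_monic x)) scale1r in Dr.
have [Qs [QsC [s1 Ds1 genQs]]] := num_field_exists r.
have [a as1 Da] : exists2 a, a \in s1 & QsC a = x.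
  have : x \in map QsC s1 by rewrite Ds1 -root_prod_XsubC -Dr root_minCpoly.
  by case/mapP => a ? ->; exists a.
have [b bs1 Db] : exists2 b, b \in s1 & QsC b = y.
  have : y \in map QsC s1 by rewrite Ds1 -root_prod_XsubC -Dr.
  by case/mapP => b ? ->; exists b.
have in_algE' := rmorph_in_alg QsC.
have ax : splitting_field_axiom Qs.
  exists (map_poly (in_alg Qs) p0); first by apply/polyOver1P; exists p0.
  exists s1 => //; suff -> : map_poly (in_alg Qs) p0 = \prod_(z <- s1) ('X - z%:P) by exact: eqpxx.
  apply: (map_inj_poly (fmorph_inj QsC) (rmorph0 _)).
  rewrite -map_poly_comp (eq_map_poly in_algE') -p0E Dr -Ds1 big_map rmorph_prod /=.
  by apply: eq_bigr => z _; rewrite rmorphB /= map_polyX map_polyC.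
pose L : splittingFieldType rat := HB.pack Qs (FieldExt_isSplittingField.Build rat Qs ax).
have rt : root (map_poly \1%VF (minPoly 1 (a : L))) (b : L).
  rewrite lfun1_poly; have /polyOver1P[q1 Dq1] := minPolyOver 1 (a : L).
  have mapq : map_poly QsC (minPoly 1 (a : L)) = map_poly ratr q1.
    by rewrite Dq1 -map_poly_comp (eq_map_poly in_algE').
  rewrite -(fmorph_root QsC) Db mapq.
  have : root (map_poly ratr q1) x.
    by rewrite -mapq -Da fmorph_root root_minPoly.
  rewrite dvd_p0 => /dvdpP[q2 ->]; rewrite rmorphM rootM /= -p0E xy orbT //.
have hom1 : kHom 1 1 (\1%VF : 'End(L)) by rewrite kHom1.
have homf : kHom 1 <<1; (a : L)>> (kHomExtend 1 \1 (a : L) (b : L)) by apply: kHomExtendP.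
have [g Dg] := kHom_to_AEnd homf.
have ga : g (a : L) = (b : L).
  by rewrite -Dg ?memv_adjoin // (kHomExtend_val hom1).
have gm : monoid_morphism (g : L -> L).
  by apply/kHom_monoid_morphism; exact: k1AHom.
pose gM := GRing.isMonoidMorphism.Build _ _ (g : L -> L) gm.
pose gR : {rmorphism Qs -> Qs} := HB.pack (fun_of_lfun (g : 'End(L))) gM.
have [nu Dnu] := extend_algC_subfield_aut QsC gR.
by exists nu; rewrite -Da -Dnu /= ga Db.
Qed.

Section AlgCAbs.
Variable R : realType.

Lemma le_by_rat (a b : R) : (forall q : rat, b < ratr q -> a <= ratr q) -> a <= b.
Proof.
move=> H; rewrite leNgt; apply/negP => /rat_in_itvoo[q]; rewrite in_itv /= => /andP[bq qa].
by have := H q bq; rewrite leNgt qa.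
Qed.

(** The norm of algC takes its values in algC; it is carried to R by its cut in
    the rationals. *)
Lemma algC_abs : exists W : algC -> R, is_abs W /\ forall q : rat, W (ratr q) = ratr `|q|.
Proof.
pose S (x : algC) := [set (ratr q : R) | q in [set q : rat | ratr q <= `|x|]].
pose W x := sup (S x).
have up (x : algC) : exists n : nat, forall q : rat, ratr q <= `|x| -> q <= n%:R.
  have h0 : 0 <= `|x| by exact: normr_ge0.
  have hn : `|x| < (Num.bound `|x|)%:R by exact: archi_boundP.
  exists (Num.bound `|x|) => q hq.
  rewrite -(ler_rat algC) ratr_nat; apply: le_trans hq _; exact: ltW.
have hasS (x : algC) : has_sup (S x).
  split; first by exists (ratr 0); exists 0 => //=; rewrite rmorph0 normr_ge0.
  have [n hn] := up x; exists n%:R => _ [q /= hq <-].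
  by rewrite -(ratr_nat R n) ler_rat hn.
have lo (x : algC) (q : rat) : ratr q <= `|x| -> ratr q <= W x.
  by move=> hq; apply: sup_upper_bound (hasS x) _ _; exists q.
have hi (x : algC) (q : rat) : `|x| <= ratr q -> W x <= ratr q.
  move=> hq; apply: sup_le_ub; first by have [] := hasS x.
  by move=> _ [q' /= hq' <-]; rewrite ler_rat -(ler_rat algC) (le_trans hq').
have cmp (x : algC) (q : rat) : (`|x| <= ratr q) || (ratr q <= `|x|).
  by apply: real_leVge; rewrite ?normr_real // Creal_Crat // Crat_rat.
have hi' (x : algC) (q : rat) : W x < ratr q -> `|x| <= ratr q.
  by move=> lt; case/orP: (cmp x q) => // /lo; rewrite leNgt lt.
have lo' (x : algC) (q : rat) : ratr q < W x -> ratr q <= `|x|.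
  by move=> lt; case/orP: (cmp x q) => // /hi; rewrite leNgt lt.
have Wrat q : W (ratr q) = ratr `|q|.
  have E : `|ratr q : algC| = ratr `|q| by rewrite ratr_norm.
  by apply/eqP; rewrite eq_le hi ?E ?lo ?E.
have W_ge0 x : 0 <= W x by rewrite -(rmorph0 (@ratr R)); apply: lo; rewrite rmorph0.
have pos (x : algC) (q : rat) : W x < ratr q -> 0 < q.
  by move=> /(le_lt_trans (W_ge0 x)); rewrite -(rmorph0 (@ratr R)) ltr_rat.
have WD x y : W (x + y) <= W x + W y.
  rewrite -lerBlDr; apply: le_by_rat => q /hi' hx; rewrite lerBlDr -lerBlDl.
  apply: le_by_rat => q' /hi' hy; rewrite lerBlDl -rmorphD; apply: hi.
  by rewrite rmorphD /=; apply: le_trans (ler_normD _ _) _; rewrite lerD.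
have Wsub x y : W (x * y) <= W x * W y.
  have step q : W x < ratr q -> W (x * y) <= ratr q * W y.
    move=> hq; have q0 := pos _ _ hq; have q0R : 0 < ratr q :> R by rewrite ltr0q.
    rewrite -ler_pdivrMl //; apply: le_by_rat => q' hq'; rewrite ler_pdivrMl // -rmorphM.
    by apply: hi; rewrite normrM rmorphM /= ler_pM ?hi'.
  have [Wy0|Wy0] := eqVneq (W y) 0.
    have [n hn] := up x; rewrite Wy0 mulr0.
    have := @step n.+1%:R; rewrite Wy0 mulr0; apply.
    rewrite ratr_nat; apply: le_lt_trans (_ : n%:R < _); last by rewrite ltr_nat.
    apply: sup_le_ub => [|_ [q /= hq <-]]; first by have [] := hasS x.
    by rewrite -(ratr_nat R n) ler_rat hn.
  have Wy : 0 < W y by rewrite lt_def Wy0 W_ge0.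
  by rewrite -ler_pdivrMr //; apply: le_by_rat => q /step; rewrite ler_pdivrMr.
have W1 : W 1 = 1 by rewrite -(rmorph1 (@ratr algC)) Wrat normr1 rmorph1.
have W_gt0 x : x != 0 -> 0 < W x.
  move=> x0; rewrite lt_def W_ge0 andbT; apply: contraTneq (@ltr01 R) => Wx0.
  by rewrite -W1 -(mulfV x0) -leNgt (le_trans (Wsub _ _)) // Wx0 mul0r.
have WV x : x != 0 -> W x^-1 <= (W x)^-1.
  move=> x0; have Wx := W_gt0 x x0; rewrite -[W x^-1]invrK lef_pV2 ?posrE ?invr_gt0 ?W_gt0 ?invr_eq0 //.
  rewrite leNgt; apply/negP => /rat_in_itvoo[q]; rewrite in_itv /= => /andP[h1 h2].
  have q0R : 0 < ratr q :> R by apply: lt_trans h1; rewrite invr_gt0 W_gt0 ?invr_eq0.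
  have q0 : 0 < q by rewrite -(ltr0q R).
  have hx := lo' _ _ h2.
  have : W x^-1 <= ratr q^-1.
    by apply: hi; rewrite normfV fmorphV /= lef_pV2 // posrE ?normr_gt0 // ltr0q.
  by rewrite fmorphV leNgt -[W x^-1]invrK ltf_pV2 ?posrE ?invr_gt0 ?W_gt0 ?invr_eq0 // h1.
have W0 : W 0 = 0 by rewrite -(rmorph0 (@ratr algC)) Wrat normr0 rmorph0.
exists W; split=> //; split=> // [x|x y].
  split=> [Wx|->//]; apply/eqP; apply: contrapT => /negP /W_gt0.
  by rewrite Wx ltxx.
have [->|y0] := eqVneq y 0; first by rewrite !mulr0 W0 mulr0.
apply/eqP; rewrite eq_le Wsub /= -ler_pdivlMr ?W_gt0 //.
rewrite -{1}[x](mulfK y0); apply: le_trans (Wsub _ _) _.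
by rewrite ler_wpM2l ?WV.
Qed.
End AlgCAbs.

(** * Weak approximation *)

Section WeakApproximation.
Variables (R : realType) (K : fieldType) (a : K).

(** Distinct absolute values that agree at one element a of value > 1 are
    inequivalent: if u x < v x, then for large n there is a power of v a
    between u x^n and v x^n. *)
Lemma separate_abs (u v : K -> R) : is_abs u -> is_abs v -> u a = v a -> 1 < v a ->
  u <> v -> exists y, u y < 1 /\ 1 < v y.
Proof.
move=> Hu Hv uva va1 neq.
have va0 : 0 < v a by apply: lt_trans va1.
have [x ltx] : exists x, u x < v x.
  have [x nx] : exists x, u x != v x.
    apply: contrapT => H; apply: neq; apply/funext => x; apply/eqP; apply: contrapT => /negP nx.
    by apply: H; exists x.
  have x0 : x != 0 by apply: contra_neq nx => ->; rewrite !abs0.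
  have [lt|gt|eq] := ltgtP (u x) (v x); [by exists x| |by rewrite eq eqxx in nx].
  by exists x^-1; rewrite !absV // ltf_pV2 // posrE abs_gt0.
have x0 : x != 0 by apply: contraTneq ltx => ->; rewrite !abs0 // ltxx.
have ux : 0 < u x by rewrite abs_gt0.
have [n hn] : exists n, v a < (v x / u x) ^+ n by apply: exprn_unbounded; rewrite ltr_pdivlMr // mul1r.
(* Scaling by a^j makes the value at u exceed 1, so that the least m with
   d < (v a)^m gives a power of v a within a factor v a above d. *)
set c := u x ^+ n; have c0 : 0 < c by rewrite exprn_gt0.
have [j hj] := exprn_unbounded c^-1 va1.
set d := c * v a ^+ j; have d1 : 1 < d by rewrite /d -ltr_pdivrMl // mulr1.
have ex : exists m, d < v a ^+ m := exprn_unbounded d va1.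
have [m hm minm] := ex_minnP ex.
have am : 0 < v a ^+ m by rewrite exprn_gt0.
exists (x ^+ n * a ^+ j / a ^+ m); split.
  by rewrite (absf Hu) (absM Hu) !(absX Hu) uva -/c -/d ltr_pdivrMr // mul1r.
rewrite (absf Hv) (absM Hv) !(absX Hv) ltr_pdivlMr // mul1r.
have le : v a ^+ m <= v a * d.
  case: m minm {hm am} => [|m] minm; first by rewrite expr0; apply: ltW; rewrite -[1]mulr1 ltr_pM.
  by rewrite exprS ler_pM2l // leNgt; apply/negP => /minm; rewrite ltnn.
apply: le_lt_trans le _; rewrite /d mulrA ltr_pM2r ?exprn_gt0 //.
by rewrite -ltr_pdivlMr // -expr_div_n.
Qed.

Lemma near_exprn_lt (r eps : R) : 0 <= r < 1 -> 0 < eps -> \forall n \near \oo, r ^+ n < eps.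
Proof.
move=> /andP[r0 r1] e0; have : (fun n => r ^+ n) @ \oo --> (0 : R).
  by apply: cvg_expr; rewrite ger0_norm.
by move/cvgr_lt; apply.
Qed.

Lemma near_exprn_gt (r M : R) : 1 < r -> \forall n \near \oo, M < r ^+ n.
Proof.
move=> r1; have [n0 hn0] := exprn_unbounded M r1; exists n0 => // n /= le.
by apply: lt_le_trans hn0 _; rewrite ler_eXn2l.
Qed.

(** Induction on the list.  Let y dominate on the tail and let z separate v from
    the head u j.  If u j y <= 1, then y^n z works for large n; otherwise
    z y^n / (1 + y^n) does, since y^n / (1 + y^n) tends to 1 at v and at u j, and
    to 0 on the tail. *)
Lemma dominating_element (I : finType) (v : K -> R) (s : seq I) (u : I -> K -> R) :
  is_abs v -> 1 < v a -> (forall i, i \in s -> [/\ is_abs (u i), u i a = v a & u i <> v]) ->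
  exists y, 1 < v y /\ forall i, i \in s -> u i y < 1.
Proof.
move=> Hv va1; elim: s => [|j s IHs] Hu; first by exists a.
have tail i : i \in s -> i \in j :: s by move=> si; rewrite inE si orbT.
have [|y [vy uy]] := IHs; first by move=> i /tail; apply: Hu.
have [Hj ja neqj] := Hu j (mem_head j s).
have [z [ujz vz]] := separate_abs Hj Hv ja va1 neqj.
have Hi i : i \in s -> is_abs (u i) by move=> /tail /Hu[].
have y0 : y != 0 by rewrite -(abs_gt0 Hv) (lt_trans ltr01).
have [ujy|ujy] := leP (u j y) 1.
  have : \forall n \near \oo, forall i, i \in s -> u i y ^+ n * u i z < 1.
    apply: filter_forall => i; have [si|_] := boolP (i \in s); last exact: nearW.
    have uz1 : 0 < u i z + 1 by rewrite ltr_wpDl ?(abs_ge0 (Hi i si)).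
    have : \forall n \near \oo, u i y ^+ n < (u i z + 1)^-1.
      by apply: near_exprn_lt; rewrite ?invr_gt0 // (abs_ge0 (Hi i si)) /= uy.
    apply: filterS => n lt _; apply: le_lt_trans (_ : u i y ^+ n * (u i z + 1) < 1).
      by rewrite ler_wpM2l ?exprn_ge0 ?(abs_ge0 (Hi i si)) // lerDl.
    by rewrite -ltr_pdivlMr // mul1r.
  case=> n0 _ /(_ n0 (leqnn n0)) hn; exists (y ^+ n0 * z); split.
    rewrite (absM Hv) (absX Hv); apply: lt_le_trans vz _.
    by rewrite ler_peMl ?(abs_ge0 Hv) // exprn_ege1 // ltW.
  move=> i; rewrite inE => /orP[/eqP ->|si].
    rewrite (absM Hj) (absX Hj); apply: le_lt_trans ujz.
    by rewrite ler_piMl ?(abs_ge0 Hj) // exprn_ile1 ?(abs_ge0 Hj).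
  by rewrite (absM (Hi i si)) (absX (Hi i si)); apply: hn.
have nz n : v (y ^+ n) != 1 -> 1 + y ^+ n != 0.
  by move=> h; apply: contra_neq h => /eqP; rewrite addrC addr_eq0 => /eqP ->; rewrite absN1.
have : \forall n \near \oo, [/\ 1 < v y ^+ n, (v z - 1)^-1 < v y ^+ n,
    (1 - u j z)^-1 < u j y ^+ n &
    forall i, i \in s -> u i y ^+ n < (1 + u i z)^-1].
  near=> n; split; near: n; try exact: near_exprn_gt.
  apply: filter_forall => i; have [si|_] := boolP (i \in s); last exact: nearW.
  have : \forall n \near \oo, u i y ^+ n < (1 + u i z)^-1.
    apply: near_exprn_lt; first by rewrite (abs_ge0 (Hi i si)) /= uy.
    by rewrite invr_gt0 ltr_wpDr ?(abs_ge0 (Hi i si)).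
  by apply: filterS.
case=> n _ /(_ n (leqnn n)) [h1 h2 h3 h4].
have w0 : 1 + y ^+ n != 0 by apply: nz; rewrite (absX Hv) gt_eqF.
exists (z * (y ^+ n / (1 + y ^+ n))); split.
  rewrite (absM Hv) (absf Hv) (absX Hv) mulrA ltr_pdivlMr ?(abs_gt0 Hv) // mul1r.
  apply: le_lt_trans (abs_triangle Hv _ _) _; rewrite (abs1 Hv) (absX Hv).
  have : 1 < (v z - 1) * v y ^+ n by rewrite -ltr_pdivrMl ?subr_gt0 // mulr1.
  by rewrite mulrBl mul1r ltrBrDr.
have lower (w : K -> R) : is_abs w ->
    w (y ^+ n) - 1 <= w (1 + y ^+ n) /\ 1 - w (y ^+ n) <= w (1 + y ^+ n).
  move=> Hw; split; rewrite lerBlDr.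
    by rewrite -{1}[y ^+ n](addKr 1) addrC -(absN1 Hw) abs_triangle.
  by rewrite -{1}(abs1 Hw) -{1}[1](addrK (y ^+ n)) -(absN Hw (y ^+ n)) abs_triangle.
move=> i; rewrite inE => /orP[/eqP ->|si].
  rewrite (absM Hj) (absf Hj) mulrA ltr_pdivrMr ?(abs_gt0 Hj) // mul1r (absX Hj).
  have [+ _] := lower _ Hj; apply: lt_le_trans; rewrite (absX Hj).
  have h : 1 < (1 - u j z) * u j y ^+ n by rewrite -ltr_pdivrMl ?subr_gt0 // mulr1.
  by move: h; rewrite mulrBl mul1r ltrBrDl ltrBrDr.
have Hui := Hi i si.
rewrite (absM Hui) (absf Hui) mulrA ltr_pdivrMr ?(abs_gt0 Hui) // mul1r (absX Hui).
have [_ +] := lower _ Hui; apply: lt_le_trans; rewrite (absX Hui).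
have c0 : 0 < 1 + u i z by rewrite ltr_wpDr ?(abs_ge0 Hui).
have := h4 i si; rewrite -[X in _ < X]mul1r ltr_pdivlMr //= => h.
by rewrite ltrBrDr mulrC -{2}[u i y ^+ n]mulr1 -mulrDr addrC.
Unshelve. all: by end_near. Qed.

(** The element y^n / (1 + y^n) for y dominating at u j. *)
Lemma approximate_idempotent (I : finType) (u : I -> K -> R) (eps : R) (j : I) : 0 < eps ->
  (forall i, is_abs (u i) /\ u i a = u j a) -> 1 < u j a -> (forall i, i != j -> u i <> u j) ->
  exists e, u j (e - 1) < eps /\ forall i, i != j -> u i e < eps.
Proof.
move=> eps0 Hu va1 neq; have [Hv _] := Hu j.
have [|y [vy uy]] := @dominating_element I (u j) [seq i <- enum I | i != j] u Hv va1.
  by move=> i; rewrite mem_filter => /andP[/neq ne _]; have [] := Hu i.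
have {}uy i : i != j -> u i y < 1 by move=> ne; apply: uy; rewrite mem_filter ne mem_enum.
have : \forall n \near \oo, [/\ 1 < u j y ^+ n, 1 + eps^-1 < u j y ^+ n &
    forall i, i != j -> u i y ^+ n < eps / (1 + eps)].
  near=> n; split; near: n; try exact: near_exprn_gt.
  apply: filter_forall => i; have [_|ne] := eqVneq i j; first exact: nearW.
  have [Hui _] := Hu i.
  have : \forall n \near \oo, u i y ^+ n < eps / (1 + eps).
    by apply: near_exprn_lt; rewrite ?(abs_ge0 Hui) ?uy //= divr_gt0 // addr_gt0.
  by apply: filterS.
case=> n _ /(_ n (leqnn n)) [h1 h2 h3].
have w0 : 1 + y ^+ n != 0.
  apply/eqP => /eqP; rewrite addrC addr_eq0 => /eqP E.
  by move: h1; rewrite -(absX Hv) E (absN1 Hv) ltxx.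
exists (y ^+ n / (1 + y ^+ n)); split.
  have -> : y ^+ n / (1 + y ^+ n) - 1 = - (1 + y ^+ n)^-1 by field.
  rewrite (absN Hv) (absV Hv) -[ltRHS]invrK ltf_pV2 ?posrE ?invr_gt0 ?(abs_gt0 Hv) //.
  apply: lt_le_trans (_ : u j (y ^+ n) - 1 <= _); first by rewrite ltrBrDl (absX Hv).
  by rewrite lerBlDr -{1}[y ^+ n](addKr 1) addrC -(absN1 Hv) abs_triangle.
move=> i ne; have [Hui _] := Hu i; rewrite (absf Hui) ltr_pdivrMr ?(abs_gt0 Hui) //.
apply: lt_le_trans (_ : eps * (1 - u i (y ^+ n)) <= _); last first.
  rewrite ler_wpM2l ?(ltW eps0) // lerBlDr -{1}(abs1 Hui) -{1}[1](addrK (y ^+ n)).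
  by rewrite -(absN Hui (y ^+ n)) abs_triangle.
have := h3 i ne; rewrite /= ltr_pdivlMr ?addr_gt0 // (absX Hui) => h.
by rewrite mulrBr mulr1 ltrBrDr [eps * _]mulrC -{1}[u i y ^+ n]mulr1 -mulrDr.
Unshelve. all: by end_near. Qed.

End WeakApproximation.

(** * Places of a number field *)

Section Places.
Variables (R : realType) (K : fieldExtType rat).

Lemma natK n : n%:R = (n%:R : rat)%:A :> K.
Proof. by rewrite scaler_nat. Qed.

Lemma padic_abs_nat p n : (0 < n)%N -> padic_abs R p n%:R = (p%:R ^+ logn p n)^-1.
Proof.
move=> n0; rewrite /padic_abs pnatr_eq0 (gtn_eqF n0) -[n%:R]/(n%:Z%:~R) denq_int numq_int.
by rewrite logn1 expr0 div1r.
Qed.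

Lemma nonarch_nat p (v : K -> R) : prime p -> is_abs v ->
  (forall q : rat, v q%:A = padic_abs R p q) ->
  [/\ forall n, v n%:R <= 1, ultrametric v, 0 < v p%:R < 1 &
    forall n, ~~ (p %| n)%N -> v n%:R = 1].
Proof.
move=> pp Hv vQ.
have p1 : 1 < p%:R :> R by rewrite ltr1n prime_gt1.
have vn n : (0 < n)%N -> v n%:R = (p%:R ^+ logn p n)^-1 by move=> n0; rewrite natK vQ padic_abs_nat.
have le1 n : v n%:R <= 1.
  case: n => [|n]; first by rewrite abs0.
  by rewrite vn // invf_le1 ?exprn_gt0 ?exprn_ege1 // ?ltW // (lt_trans ltr01).
split=> //; first exact: ultrametric_of_nat.
  by rewrite vn ?prime_gt0 // logn_prime // eqxx expr1 invr_gt0 invf_lt1 ?(lt_trans ltr01) //.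
move=> n; case: n => [|n]; first by rewrite dvdn0.
by move=> np; rewrite vn // lognE pp (negbTE np) andbF expr0 invr1.
Qed.

Lemma coef_prod_bound (W : algC -> R) (s : seq algC) i : is_abs W ->
  (forall r, r \in s -> W r <= 1) -> W (\prod_(r <- s) ('X - r%:P))`_i <= 2 ^+ size s.
Proof.
move=> HW; elim: s i => [|r s IHs] i Ws.
  by rewrite big_nil coef1 expr0; case: eqP => _; rewrite ?abs1 ?abs0.
rewrite big_cons mulrBl coefB coefCM coefXM exprS mulr_natl mulr2n.
apply: le_trans (abs_triangle HW _ _) _.
have IH j : W (\prod_(r <- s) ('X - r%:P))`_j <= 2 ^+ size s.
  by apply: IHs => t ts; apply: Ws; rewrite inE ts orbT.
rewrite (absN HW) (absM HW) lerD //.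
  by case: eqP => _; rewrite ?IH // (abs0 HW) exprn_ge0.
by rewrite -[leRHS]mul1r; apply: ler_pM; rewrite ?(abs_ge0 HW) // Ws // inE eqxx.
Qed.

Lemma rat_minpoly (iota : {rmorphism K -> algC}) (x : K) :
  exists q : {poly rat}, [/\ q \is monic, (size q <= (\dim {:K}).+1)%N,
    root (map_poly (in_alg K) q) x &
    forall r, root (map_poly ratr q) r -> root (minCpoly (iota x)) r].
Proof.
have /polyOver1P[q Dq] := minPolyOver 1 x.
have inE' := rmorph_in_alg iota.
exists q; split.
- by rewrite -(map_monic (in_alg K)) -Dq monic_minPoly.
- rewrite -(size_map_poly (in_alg K)) -Dq size_minPoly ltnS.
  by rewrite adjoin_degreeE dimv1 divn1 dimvS ?subvf.
- by rewrite -Dq root_minPoly.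
move=> r; have [p [-> _] dvd_p] := minCpolyP (iota x).
suff /dvdpP[s ->] : q %| p by rewrite rmorphM rootM => ->; rewrite orbT.
rewrite -(dvdp_map (in_alg K)) -Dq minPoly_dvdp //; first by apply/polyOver1P; exists p.
rewrite -(fmorph_root iota) -map_poly_comp (eq_map_poly inE') dvd_p.
exact: dvdpp.
Qed.

(** A generator z of iota K has finitely many conjugates, hence iota K has
    finitely many embeddings nu_i into algC.  If v is none of the W o nu_i, some y
    in K has v y > 1 and all W (nu_i y) < 1.  The minimal polynomial of y^n then has
    coefficients bounded by 2^D, D = [K : Q], so v (y^n) <= D 2^D for all n, which
    is absurd. *)
Lemma archimedean_embedding (iota : {rmorphism K -> algC}) (v : K -> R) (W : algC -> R) :
  is_abs v -> (forall q : rat, v q%:A = ratr `|q|) ->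
  is_abs W -> (forall q : rat, W (ratr q) = ratr `|q|) ->
  exists nu : {rmorphism algC -> algC}, forall x, v x = W (nu (iota x)).
Proof.
move=> Hv vQ HW WQ.
have [z [c Dz] [ps Dps]] := algC_PET (map iota (vbasis {:K})).
have gen x : exists p : {poly rat}, iota x = (map_poly ratr p).[z].
  have : x \in <<vbasis {:K}>>%VS by rewrite (span_basis (vbasisP _)) memvf.
  move/coord_span => ->; rewrite rmorph_sum /=.
  have si (i : 'I_(\dim {:K})) : exists p : {poly rat}, iota (vbasis {:K})`_i = (map_poly ratr p).[z].
    exists ps`_i; have := congr1 (fun s => s`_i) Dps.
    have lt : (i < size (vbasis {:K}))%N by rewrite size_tuple.
    rewrite (nth_map 0) // => ->; rewrite (nth_map 0) //.
    by have := congr1 size Dps; rewrite !size_map => <-.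
  have [f Df] := choice si.
  exists (\sum_i coord (vbasis {:K}) i x *: f i).
  rewrite rmorph_sum /= horner_sum; apply: eq_bigr => i _.
  by rewrite rmorphZ_num Df map_polyZ hornerZ.
have [r Dr] := closed_field_poly_normal (minCpoly z).
rewrite (monicP (minCpoly_monic z)) scale1r in Dr.
have nuP i : exists nu : {rmorphism algC -> algC}, (i < size r)%N -> nu z = r`_i.
  have [lt|ge] := ltnP i (size r); last by exists idfun.
  have [|nu Dnu] := @conjugate_by_automorphism z r`_i; last by exists nu.
  by rewrite Dr root_prod_XsubC mem_nth.
have [nu Dnu] := choice nuP.
apply: contrapT => none.
pose u i x := W (nu i (iota x)).
have Hu i : is_abs (u i) by exact: (is_abs_comp iota (is_abs_comp (nu i) HW)).
have v2 : 1 < v 2%:R by rewrite natK vQ ger0_norm // ratr_nat ltr1n.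
have Hall (i : 'I_(size r)) : i \in enum 'I_(size r) -> [/\ is_abs (u i), u i 2%:R = v 2%:R & u i <> v].
  move=> _; split=> // [|uv]; last by apply: none; exists (nu i) => x; rewrite -uv.
  by rewrite /u !rmorph_nat natK vQ -WQ ratr_nat.
have [y [vy uy]] := dominating_element (u := fun i : 'I_(size r) => u i) Hv v2 Hall.
set D := \dim {:K}.
have [n hn] := exprn_unbounded (D%:R * 2 ^+ D) vy.
have [q [mon_q size_q rt_q roots_q]] := rat_minpoly iota (y ^+ n).
have [s Ds] := closed_field_poly_normal (map_poly (ratr : rat -> algC) q).
have mon_q' : map_poly (ratr : rat -> algC) q \is monic by rewrite map_monic.
rewrite (monicP mon_q') scale1r in Ds.
have size_s : size q = (size s).+1.
  by rewrite -(size_map_poly (ratr : {rmorphism rat -> algC})) Ds size_prod_XsubC.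
have small r0 : r0 \in s -> W r0 <= 1.
  rewrite -root_prod_XsubC -Ds => /roots_q /conjugate_by_automorphism[mu Dmu].
  have : root (minCpoly z) (mu z) by rewrite -(minCpoly_aut mu) root_minCpoly.
  rewrite Dr root_prod_XsubC => /(nthP 0)[i lti Di].
  have [p Dp] := gen (y ^+ n).
  have <- : nu i (iota (y ^+ n)) = r0.
    rewrite -Dmu Dp -!horner_map /= Dnu // Di -!map_poly_comp; congr (_.[_]).
    by apply: eq_map_poly => b; rewrite /= !fmorph_rat.
  rewrite -/(u i (y ^+ n)) (absX (Hu i)) exprn_ile1 ?(abs_ge0 (Hu i)) // ltW //.
  by rewrite (uy (Ordinal lti)) // mem_enum.
have coef i : v (q`_i)%:A <= 2 ^+ D.
  rewrite vQ -WQ -coef_map Ds; apply: le_trans (coef_prod_bound i HW small) _.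
  by rewrite ler_eXn2l ?ltr1n // -ltnS -size_s.
set x := y ^+ n in rt_q hn *; have vx : v x = v y ^+ n by rewrite (absX Hv).
have vx1 : 1 <= v x by rewrite vx exprn_ege1 // ltW.
have lead : q`_(size s) = 1 by have := monicP mon_q; rewrite lead_coefE size_s.
have E : x ^+ size s = - \sum_(i < size s) (q`_i)%:A * x ^+ i.
  apply/eqP; rewrite -addr_eq0 addrC; move: rt_q; rewrite /root horner_coef size_map_poly size_s.
  rewrite big_ord_recr /= coef_map /= lead scale1r mul1r.
  by under eq_bigr do rewrite coef_map /=.
have : v x ^+ size s <= (size s)%:R * 2 ^+ D * v x ^+ (size s).-1.
  rewrite -(absX Hv) E (absN Hv); apply: le_trans (abs_sum Hv _ _ _) _.
  have -> : (size s)%:R * 2 ^+ D * v x ^+ (size s).-1 =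
      \sum_(i < size s) 2 ^+ D * v x ^+ (size s).-1.
    by rewrite sumr_const card_ord -mulrA mulr_natl.
  apply: ler_sum => i _.
  rewrite (absM Hv) (absX Hv); apply: ler_pM; rewrite ?(abs_ge0 Hv) ?exprn_ge0 ?(abs_ge0 Hv) //.
  apply: ler_weXn2l => //; rewrite -ltnS prednK ?ltn_ord //.
  exact: leq_ltn_trans (ltn_ord i).
have [s0|s0] := posnP (size s).
  by rewrite s0 expr0 mul0r mul0r leNgt ltr01.
rewrite -{1}(prednK s0) exprS ler_pM2r ?exprn_gt0 ?(lt_le_trans ltr01) // leNgt => /negP; apply.
rewrite vx; apply: le_lt_trans hn; rewrite ler_wpM2r ?exprn_ge0 // ler_nat.
by rewrite -ltnS -size_s.
Qed.

End Places.

(** * Local degrees over a place of the rationals *)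

Section LocalDegrees.
Variables (R : realType) (K : fieldExtType rat).

(** This bounds by delta, without a limit, the absolute value in the completion
    of the combination of the classes of the e_i with coefficients c_i. *)
Definition comb_eventually_le (v : K -> R) n (e : 'I_n -> nat -> K) (c : 'I_n -> rat) (delta : R) :=
  exists m0, forall m, (m0 <= m)%N -> v (\sum_i (c i)%:A * e i m) <= delta.

Section OnePlace.
Variable (v : K -> R).
Hypothesis Hv : is_abs v.
Let w (q : rat) := v q%:A.

Lemma natA_neq0 (q : rat) : (q%:A == 0 :> K) = (q == 0).
Proof. by rewrite scaler_eq0 oner_eq0 orbF. Qed.

(** Coordinates are bounded by the norm: the usual induction that uses the
    completeness of the space spanned by the other vectors.  If the j-th
    coordinate is not bounded, there are combinations c_l with c_l j = 1 that
    tend to 0; by induction the other coordinates are Cauchy sequences, and their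
    limits contradict independence. *)
Lemma norm_equivalence n (e : 'I_n -> nat -> K) :
  (forall i, abs_cauchy v (e i)) ->
  (forall c : 'I_n -> nat -> rat, (forall i, abs_cauchy v (fun k => (c i k)%:A)) ->
     abs_null v (fun k => \sum_(i < n) (c i k)%:A * e i k) ->
     forall i, abs_null v (fun k => (c i k)%:A)) ->
  exists2 Gamma, 0 <= Gamma & forall c delta, comb_eventually_le v e c delta ->
    forall i, w (c i) <= Gamma * delta.
Proof.
elim: n e => [|n IHn] e cau indep; first by exists 0 => // c delta _ [].
suff one j : exists Gamma, 0 <= Gamma /\ forall c delta, comb_eventually_le v e c delta ->
    w (c j) <= Gamma * delta.
  have [G HG] := choice one.
  exists (\sum_j G j); first by apply: sumr_ge0 => j _; have [] := HG j.
  move=> c delta hc j; have [_ /(_ c delta hc) le] := HG j; apply: le_trans le _.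
  have d0 : 0 <= delta by have [m0 /(_ m0 (leqnn _))] := hc; apply: le_trans; exact: (abs_ge0 Hv).
  rewrite ler_wpM2r // (bigD1 j) //= lerDl; apply: sumr_ge0 => i _.
  by have [] := HG i.
apply: contrapT => noG.
pose e' i := e (lift j i).
have [|G G0 HG] := IHn e' (fun i => cau (lift j i)).
  move=> c cauc nullc i.
  pose c' i := if unlift j i is Some k then c k else fun=> 0.
  have c'l k : c' (lift j k) = c k by rewrite /c' liftK.
  have c'j : c' j = fun=> 0 by rewrite /c' unlift_none.
  have := indep c'; rewrite -c'l; apply=> {i}; last first.
    move: nullc; congr (abs_null v _); apply/funext => k.
    rewrite (bigD1_ord j) //= c'j scale0r mul0r add0r.
    by apply: eq_bigr => i _; rewrite c'l.
  move=> i; have [k ->|->] := unliftP j i; first by rewrite c'l.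
  by rewrite c'j => eps eps0; exists 0%N => *; rewrite subrr (abs0 Hv).
have ex l : exists c : 'I_n.+1 -> rat, c j = 1 /\ comb_eventually_le v e c (l.+1%:R)^-1.
  apply: contrapT => noc; apply: noG; exists (l.+1%:R); split => // c delta [m0 hm0].
  rewrite leNgt; apply/negP => lt; apply: noc.
  have d0 : 0 <= delta by apply: le_trans (hm0 m0 (leqnn _)); exact: (abs_ge0 Hv).
  have cj : 0 < w (c j) by apply: le_lt_trans lt; rewrite mulr_ge0.
  have cj0 : c j != 0 by rewrite -natA_neq0 -(abs_gt0 Hv).
  exists (fun i => c i / c j); split; first by rewrite mulfV.
  exists m0 => m /hm0 le.
  have -> : \sum_i (c i / c j)%:A * e i m = (c j)%:A^-1 * \sum_i (c i)%:A * e i m.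
    rewrite mulr_sumr; apply: eq_bigr => i _.
    by rewrite -in_algE rmorphM fmorphV /= mulrA [_^-1 * _]mulrC.
  rewrite (absM Hv) (absV Hv) ler_pdivrMl // ler_pdivlMr ?ltr0n //.
  by apply: le_trans (_ : delta * l.+1%:R <= _); [rewrite ler_wpM2r|rewrite mulrC ltW].
have [c Hc] := choice ex.
have diff l l' i : w (c l i - c l' i) <= G * ((l.+1%:R)^-1 + (l'.+1%:R)^-1).
  have [k ->|->] := unliftP j i; last first.
    have [-> _] := Hc l; have [-> _] := Hc l'.
    by rewrite subrr /w scale0r (abs0 Hv) mulr_ge0 ?addr_ge0 ?invr_ge0.
  apply: (HG (fun k => c l (lift j k) - c l' (lift j k))).
  have [cl [m0 hm0]] := Hc l; have [cl' [m1 hm1]] := Hc l'.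
  exists (maxn m0 m1) => m; rewrite geq_max => /andP[/hm0 h0 /hm1 h1].
  have -> : \sum_i (c l (lift j i) - c l' (lift j i))%:A * e' i m =
      \sum_i (c l i)%:A * e i m - \sum_i (c l' i)%:A * e i m.
    rewrite -sumrB (bigD1_ord j) //= cl cl' subrr add0r; apply: eq_bigr => i' _.
    by rewrite scalerBl mulrBl.
  by apply: le_trans (abs_triangle Hv _ _) _; rewrite (absN Hv) lerD.
have invn (eps : R) : 0 < eps -> exists n0, forall l, (n0 <= l)%N -> (l.+1%:R)^-1 <= eps.
  move=> eps0; exists (Num.trunc eps^-1) => l le.
  rewrite -[leRHS]invrK lef_pV2 ?posrE ?invr_gt0 ?ltr0n // ltW //.
  by apply: lt_le_trans (truncnS_gt _) _; rewrite ler_nat ltnS.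
have cauc i : abs_cauchy v (fun k => (c k i)%:A).
  move=> eps eps0; have G1 : 0 < 2 * (G + 1) by rewrite mulr_gt0 // ltr_wpDl.
  have [n0 hn0] := invn (eps / (2 * (G + 1))) (divr_gt0 eps0 G1).
  exists n0 => l l' hl hl'; rewrite -scalerBl; apply: le_lt_trans (diff l l' i) _.
  apply: le_lt_trans (_ : G * (eps / (G + 1)) < _).
    rewrite ler_wpM2l //; apply: le_trans (lerD (hn0 _ hl) (hn0 _ hl')) _.
    by rewrite le_eqVlt; apply/orP; left; apply/eqP; field; rewrite gt_eqF // ltr_wpDl.
  by rewrite mulrCA -[ltRHS]mulr1 ltr_pM2l // ltr_pdivrMr ?ltr_wpDl // mul1r ltrDl.
have nullj : abs_null v (fun k => (c k j)%:A).
  apply: (indep (fun i k => c k i)) => //.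
  have bnd : exists2 B, 0 <= B & forall l i, w (c l i) <= B.
    exists (\sum_i w (c 0%N i) + G * 2) => [|l i].
      by rewrite addr_ge0 ?mulr_ge0 // sumr_ge0 // => i _; exact: (abs_ge0 Hv).
    have -> : c l i = c 0%N i + (c l i - c 0%N i) by rewrite addrC subrK.
    rewrite /w scalerDl; apply: le_trans (abs_triangle Hv _ _) _; apply: lerD.
      by rewrite (bigD1 i) //= lerDl sumr_ge0 // => i' _; exact: (abs_ge0 Hv).
    apply: le_trans (diff _ _ _) _; rewrite ler_wpM2l // -[2]/(1 + 1) lerD //.
      by rewrite invf_le1 ?ltr0n // ler1n.
    by rewrite invr1.
  have [B B0 HB] := bnd.
  apply/cvgr0Pnorm_lt => eps eps0.
  have eps3 : 0 < eps / 3 by rewrite divr_gt0.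
  have [n0 hn0] := invn (eps / 3) eps3.
  have den : 0 < B * n.+1%:R + 1 by rewrite ltr_wpDl // mulr_ge0.
  have cauE i : exists m, forall k l, (m <= k)%N -> (m <= l)%N ->
      v (e i k - e i l) < eps / 3 / (B * n.+1%:R + 1).
    exact: (cau i _ (divr_gt0 eps3 den)).
  have [M HM] := choice cauE.
  exists (maxn n0 (\max_i M i)) => // l /=; rewrite geq_max => /andP[n0l Ml].
  rewrite ger0_norm ?(abs_ge0 Hv) //.
  have [_ [m0 hm0]] := Hc l.
  set m := maxn m0 l; have {}hm0 := hm0 m (leq_maxl _ _).
  have -> : \sum_(i < n.+1) (c l i)%:A * e i l =
      \sum_(i < n.+1) (c l i)%:A * e i m + \sum_(i < n.+1) (c l i)%:A * (e i l - e i m).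
    by rewrite -big_split /=; apply: eq_bigr => i _; rewrite mulrBr addrC subrK.
  apply: le_lt_trans (abs_triangle Hv _ _) _.
  have h1 : v (\sum_(i < n.+1) (c l i)%:A * e i m) <= eps / 3 by apply: le_trans hm0 _; apply: hn0.
  have h2 : v (\sum_(i < n.+1) (c l i)%:A * (e i l - e i m)) <= eps / 3.
    apply: le_trans (abs_sum Hv _ _ _) _.
    apply: le_trans (_ : \sum_(i < n.+1) B * (eps / 3 / (B * n.+1%:R + 1)) <= _).
      apply: ler_sum => i _; rewrite (absM Hv) ler_pM ?(abs_ge0 Hv) ?HB // ltW // HM //.
        by apply: leq_trans Ml; exact: leq_bigmax.
      by apply: leq_trans (leq_maxr _ _); apply: leq_trans Ml; exact: leq_bigmax.
    rewrite sumr_const card_ord -[_ *+ _]mulr_natr.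
    set q := eps / 3 / _; have q0 : 0 <= q by rewrite ltW // divr_gt0.
    apply: le_trans (_ : q * (B * n.+1%:R + 1) <= _); last by rewrite /q divfK // gt_eqF.
    have -> : B * q * n.+1%:R = q * (B * n.+1%:R) by ring.
    by rewrite mulrDr mulr1 lerDl.
  by apply: le_lt_trans (lerD h1 h2) _; lra.
have := nullj; have -> : (fun k => (c k j)%:A) = (fun=> 1 : K).
  by apply/funext => k; have [-> _] := Hc k; rewrite scale1r.
rewrite /abs_null (abs1 Hv) => /cvg_lim; rewrite lim_cst // => /(_ (@Rhausdorff R)) /eqP.
by rewrite oner_eq0.
Qed.
End OnePlace.

(** If the bases had more than [K : Q] elements in all, elements theta of K
    close to one basis vector at its own place and to 0 at the other places would
    satisfy a linear relation over Q.  Near the place of its largest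
    coefficient, this relation is a combination of the basis vectors at that
    place which is too small for [norm_equivalence]. *)
Lemma completion_degrees_bound (w : rat -> R) (a : rat) (I : finType) (u : I -> K -> R)
    (n : I -> nat) (e : forall i, 'I_(n i) -> nat -> K) :
  (forall i, is_abs (u i)) -> (forall i q, u i q%:A = w q) -> 1 < w a ->
  (forall i j, i != j -> u i <> u j) ->
  (forall i, completion_basis (u i) (e i)) -> (\sum_i n i <= \dim {:K})%N.
Proof.
move=> Hu uw wa neq bas; pose T : finType := {i : I & 'I_(n i)}.
have cardT : #|{: T}| = (\sum_i n i)%N.
  rewrite card_tagged sumnE big_map big_enum /=.
  by apply: eq_bigr => i _; rewrite card_ord.
rewrite -cardT leqNgt; apply/negP => ltDT.
have cau i k : abs_cauchy (u i) (e i k) by have [] := bas i.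
have exG i : exists Gamma, 0 <= Gamma /\ forall c delta, comb_eventually_le (u i) (e i) c delta ->
    forall k, w (c k) <= Gamma * delta.
  have [|G G0 HG] := norm_equivalence (Hu i) (cau i); first by have [] := bas i.
  by exists G; split => // c delta /HG H k; rewrite -(uw i).
have [G HG] := choice exG.
set t : R := #|{: T}|%:R; have t0 : 0 <= t by exact: ler0n.
have GS0 : 0 <= \sum_i G i by apply: sumr_ge0 => i _; have [] := HG i.
have den0 : 0 < t * 2 * (\sum_i G i) + 1 by rewrite ltr_wpDl // !mulr_ge0.
pose eps := (t * 2 * (\sum_i G i) + 1)^-1; have eps0 : 0 < eps by rewrite invr_gt0.
have exM i : exists M, forall k m, (M <= m)%N -> u i (e i k m - e i k M) < eps.
  have [f Hf] := choice (fun k => cau i k eps eps0).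
  exists (\max_k f k) => k m le; have lek : (f k <= \max_k f k)%N by exact: leq_bigmax.
  by apply: Hf => //; apply: leq_trans le.
have [M HM] := choice exM.
pose B i := \sum_j \sum_k u j (e i k (M i)).
have B_ge i j k : u j (e i k (M i)) <= B i.
  rewrite /B (bigD1 j) //= (bigD1 k) //= -addrA lerDl addr_ge0 ?sumr_ge0 // => [k' _|j' _].
    exact: (abs_ge0 (Hu j)).
  by apply: sumr_ge0 => k' _; exact: (abs_ge0 (Hu j')).
have B0 i : 0 <= B i.
  by apply: sumr_ge0 => j _; apply: sumr_ge0 => k _; exact: (abs_ge0 (Hu j)).
have exE i : exists E, u i (E - 1) < eps / (B i + 1) /\ forall j, j != i -> u j E < eps / (B i + 1).
  apply: (@approximate_idempotent R K (a%:A)) => [|j||j /neq //].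
  - by rewrite divr_gt0 // ltr_wpDl.
  - by rewrite !uw.
  by rewrite uw.
have [E HE] := choice exE.
have small i x y : 0 <= x -> x < eps / (B i + 1) -> y <= B i -> 0 <= y -> x * y <= eps.
  move=> x0 hx hy y0; have B1 : 0 < B i + 1 by rewrite ltr_wpDl.
  apply: le_trans (_ : eps / (B i + 1) * (B i + 1) <= _); last by rewrite divfK // gt_eqF.
  by rewrite ler_pM // ?ltW // (le_lt_trans hy) // ltrDl.
pose tg i (k : 'I_(n i)) : T := Tagged (fun i => 'I_(n i)) k.
pose theta (p : T) := E (tag p) * e (tag p) (tagged p) (M (tag p)).
have [c [t1 ct1] csum] : exists2 c : T -> rat, exists p, c p != 0 & \sum_p (c p)%:A * theta p = 0.
  pose X := [tuple theta (enum_val i) | i < #|{: T}|].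
  have nfree : ~~ free X.
    apply: contraL ltDT => /eqP; rewrite size_tuple -leqNgt => <-.
    by rewrite dimvS ?subvf.
  apply: contrapT => noc; move/negP: nfree; apply; apply/freeP => k ksum i.
  apply/eqP; apply: contrapT => /negP ki; apply: noc.
  exists (fun p => k (enum_rank p)); first by exists (enum_val i); rewrite enum_valK.
  have XE (j : 'I_#|{: T}|) : X`_j = theta (enum_val j) by rewrite -tnth_nth tnth_mktuple.
  move: ksum; under eq_bigr do rewrite XE; move=> ksum.
  rewrite -[RHS]ksum (reindex_onto enum_rank enum_val) /=; last by move=> i' _; rewrite enum_valK.
  apply: eq_big => [p|p _]; first by rewrite enum_rankK eqxx.
  by rewrite enum_rankK mulr_algl.
have w0 q : 0 <= w q by rewrite -(uw (tag t1)) (abs_ge0 (Hu _)).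
case: (@arg_maxP _ _ T t1 xpredT (fun p => w (c p)) isT) => [[i0 k0] _ maxc].
have cmax : 0 < w (c (tg i0 k0)).
  apply: lt_le_trans (maxc t1 isT); rewrite -(uw (tag t1)) (abs_gt0 (Hu _)).
  by rewrite natA_neq0.
have [G0 /(_ (fun k => c (tg i0 k)) (w (c (tg i0 k0)) * (t * (2 * eps)))) HG0] := HG i0.
have : comb_eventually_le (u i0) (e i0) (fun k => c (tg i0 k)) (w (c (tg i0 k0)) * (t * (2 * eps))).
  exists (M i0) => m hm.
  pose g (p : T) := if tag p == i0 then e (tag p) (tagged p) m else 0.
  have -> : \sum_i (c (tg i0 i))%:A * e i0 i m = \sum_p (c p)%:A * (g p - theta p).
    transitivity (\sum_p (c p)%:A * g p); last first.
      under [RHS]eq_bigr do rewrite mulrBr.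
      by rewrite sumrB csum subr0.
    pose F i (k : 'I_(n i)) : K := (c (tg i k))%:A * g (tg i k).
    transitivity (\sum_i \sum_k F i k); last first.
      rewrite (@sig_big_dep _ _ _ I (fun i => 'I_(n i)) xpredT (fun i k => true) (fun i k => F i k)) /=.
      by apply: eq_big => // -[i k] _.
    rewrite (bigD1 i0) //= [X in _ + X]big1 ?addr0 => [|i ne]; last first.
      by apply: big1 => k _; rewrite /F /g /= (negbTE ne) mulr0.
    by apply: eq_bigr => k _; rewrite /F /g /= eqxx.
  apply: le_trans (abs_sum (Hu i0) _ _ _) _.
  apply: le_trans (_ : \sum_(p : T) w (c (tg i0 k0)) * (2 * eps) <= _); last first.
    by rewrite sumr_const -/t -[_ *+ _]mulr_natl mulrCA.
  apply: ler_sum => p _; rewrite (absM (Hu i0)) uw; apply: ler_pM; rewrite ?(abs_ge0 (Hu i0)) //.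
    exact: maxc.
  case: p => i k; rewrite /g /theta /=; have [Ei|ne] := eqVneq i i0; last first.
    have ui := abs_ge0 (Hu i0).
    rewrite sub0r (absN (Hu i0)) (absM (Hu i0)); apply: le_trans (_ : eps <= _); last by lra.
    by apply: (small i) => //; have [_] := HE i; apply; rewrite eq_sym.
  subst i0.
  have -> : e i k m - E i * e i k (M i) = (e i k m - e i k (M i)) - (E i - 1) * e i k (M i) by ring.
  apply: le_trans (abs_triangle (Hu i) _ _) _; rewrite (absN (Hu i)) (absM (Hu i)).
  have -> : 2 * eps = eps + eps by ring.
  apply: lerD; first by apply: ltW; apply: HM.
  by apply: (small i) => //; [exact: (abs_ge0 (Hu i))|have [] := HE i|exact: (abs_ge0 (Hu i))].
move=> /HG0/(_ k0); rewrite mulrCA -{1}[w _]mulr1 ler_pM2l // leNgt => /negP; apply.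
apply: le_lt_trans (_ : (t * 2 * \sum_i G i) * eps < 1).
  have -> : G i0 * (t * (2 * eps)) = (t * 2 * G i0) * eps by ring.
  rewrite ler_wpM2r ?(ltW eps0) // ler_wpM2l ?mulr_ge0 // (bigD1 i0) //= lerDl sumr_ge0 // => i _.
  by have [] := HG i.
by rewrite ltr_pdivrMr // mul1r ltrDl.
Qed.

Lemma local_degree_basis (v : K -> R) : local_degree v != 0%N ->
  exists e : 'I_(local_degree v) -> nat -> K, completion_basis v e.
Proof.
have [ex _|noex] := pselect (exists n, exists e : 'I_n -> nat -> K, completion_basis v e).
  exact: (xgetPex 0%N ex).
rewrite /local_degree xgetPN ?eqxx // => n hn; by apply: noex; exists n.
Qed.

Lemma sum_local_degree (w : rat -> R) (a : rat) (s : seq (K -> R)) : uniq s -> 1 < w a ->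
  (forall v, v \in s -> is_abs v /\ forall q, v q%:A = w q) ->
  (\sum_(v <- s) local_degree v <= \dim {:K})%N.
Proof.
move=> uniq_s wa Hs; pose s' := [seq v <- s | local_degree v != 0%N].
have -> : (\sum_(v <- s) local_degree v = \sum_(v <- s') local_degree v)%N.
  rewrite big_filter [RHS]big_mkcond; apply: eq_bigr => v _.
  by case: eqP.
pose u (i : 'I_(size s')) := nth (fun=> 0) s' i.
have us' i : u i \in s' by exact: mem_nth.
have us i : u i \in s by have := us' i; rewrite mem_filter => /andP[].
have ex i : exists e : 'I_(local_degree (u i)) -> nat -> K, completion_basis (u i) e.
  by apply: local_degree_basis; have := us' i; rewrite mem_filter => /andP[].
rewrite (big_nth (fun=> 0)) big_mkord.
apply: (@completion_degrees_bound w a _ u _ (fun i => sval (cid (ex i)))) => //.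
- by move=> i; have [] := Hs _ (us i).
- by move=> i; have [] := Hs _ (us i).
- move=> i j ne /eqP; rewrite nth_uniq ?filter_uniq //.
  by move=> /eqP/ord_inj E; rewrite E eqxx in ne.
by move=> i; exact: (svalP (cid (ex i))).
Qed.
End LocalDegrees.

(** * The height inequality *)

Section Assembly.
Variables (R : realType) (K : fieldExtType rat).

Definition arch_place (v : K -> R) := forall q : rat, v q%:A = ratr `|q|.
Definition padic_place p (v : K -> R) := forall q : rat, v q%:A = padic_abs R p q.

(** Each such place contributes at least 1 to the sum of the local degrees. *)
Lemma finite_places_over (w : rat -> R) (a : rat) : 1 < w a ->
  finite_set [set v : K -> R | [/\ is_abs v, forall q, v q%:A = w q & local_degree v != 0%N]].
Proof.
move=> wa; apply: contrapT => /(infinite_set_fset (\dim {:K}).+1)[B BS cardB].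
have : (\sum_(v <- finmap.enum_fset B) local_degree v <= \dim {:K})%N.
  by apply: (sum_local_degree (finmap.fset_uniq B) wa) => v /BS[].
apply/negP; rewrite -ltnNge; apply: leq_trans cardB _.
rewrite -sum1_size big_seq [leqRHS]big_seq.
by apply: leq_sum => v /BS[_ _]; rewrite lt0n.
Qed.

(** c is the product of the denominators of the coefficients of the minimal
    polynomial of x; if p does not divide it, x is integral at v. *)
Lemma padic_denominator (iota : {rmorphism K -> algC}) (x : K) :
  exists2 c : nat, (0 < c)%N &
    forall p v, prime p -> is_abs v -> padic_place p v -> 1 < v x -> (p %| c)%N.
Proof.
have [q [mon_q _ rt _]] := rat_minpoly iota x.
exists (\prod_(i < size q) `|denq q`_i|)%N.
  by rewrite prodn_gt0 // => i; rewrite absz_gt0 denq_neq0.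
move=> p v pp Hv vp vx; apply: contrapT => /negP np.
have [_ ultra _ _] := nonarch_nat pp Hv vp.
have coef i : (i < size q)%N -> v (q`_i)%:A <= 1.
  move=> lti.
  rewrite vp /padic_abs; case: eqP => // _.
  have pd : ~~ (p %| `|denq q`_i|)%N.
    by apply: contra np => pd; rewrite (bigD1 (Ordinal lti)) //= dvdn_mulr.
  rewrite lognE pp absz_gt0 denq_neq0 (negbTE pd) expr0 div1r.
  have p0 : 0 < p%:R :> R by rewrite ltr0n prime_gt0.
  by rewrite invf_le1 ?exprn_gt0 // exprn_ege1 // ler1n prime_gt0.
have q0 : (0 < size q)%N by rewrite size_poly_gt0 monic_neq0.
have lead : q`_(size q).-1 = 1 by have := monicP mon_q.
set n := (size q).-1 in lead; have Dn : size q = n.+1 by rewrite prednK.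
have E : x ^+ n = - \sum_(i < n) (q`_i)%:A * x ^+ i.
  apply/eqP; rewrite -addr_eq0 addrC; move: rt; rewrite /root horner_coef size_map_poly Dn.
  rewrite big_ord_recr /= coef_map /= lead scale1r mul1r.
  by under eq_bigr do rewrite coef_map /=.
have [n0|n0] := posnP n.
  by move/eqP: E; rewrite n0 big_ord0 expr0 oppr0 oner_eq0.
have : v x ^+ n <= v x ^+ n.-1.
  rewrite -(absX Hv) E (absN Hv); apply: ultrametric_sum => // [|i].
    by rewrite exprn_ge0 ?(abs_ge0 Hv).
  rewrite (absM Hv) (absX Hv) -[leRHS]mul1r.
  apply: ler_pM; rewrite ?(abs_ge0 Hv) ?exprn_ge0 ?(abs_ge0 Hv) //.
    by apply: coef; rewrite Dn ltnW // ltnS.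
  by apply: ler_weXn2l; [exact: ltW|rewrite -ltnS prednK].
by rewrite -{1}(prednK n0) exprS ger_pMl ?exprn_gt0 ?(lt_trans ltr01) // leNgt vx.
Qed.

Section Bounds.
Variables (N d : nat) (hN : (1 <= N)%N) (hd : (2 <= d)%N) (iota : {rmorphism K -> algC}).
Variables (A : 'M[K]_N) (b : 'cV[K]_N).
Hypotheses (detA : \det (map_mx iota A) = 1)
  (pcf : PCF (power_affine_map d (map_mx iota A) (map_mx iota b))).

Let E := (N.+1 * d.+1)%N.
Let a (v : K -> R) := \big[Num.max/0]_(i < N) \big[Num.max/0]_(j < N) v (A i j).
Let beta (v : K -> R) := \big[Num.max/0]_(i < N) v (b i 0).

Lemma log_bound_of_extension (W : algC -> R) (v : K -> R) (kappa : R) (pi : algC) :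
  is_abs W -> (forall x, W (iota x) = v x) -> 0 < W pi -> W pi < 1 -> 1 <= kappa ->
  (forall (I : finType) (f : I -> algC) M, (#|I| <= maxn 2 N`!)%N -> 0 <= M ->
    (forall i, W (f i) <= M) -> W (\sum_i f i) <= kappa * M) ->
  1 <= kappa * a v /\
  log_plus (beta v) <= E%:R * ln (a v) + (3 * d + 3 + E)%:R * ln kappa.
Proof.
move=> HW Wv pi0 pi1 k1 sumW.
have [z zP] := C_prim_root_exists (ltnW hd).
have Aa i j : W (map_mx iota A i j) <= a v.
  rewrite mxE Wv; apply: le_trans (le_bigmax 0 _ i).
  exact: (le_bigmax 0 (fun j => v (A i j))).
have a0 : 0 <= a v by apply: bigmax_ge_id.
have ka1 : 1 <= kappa * a v.
  exact: (unimodular_entries_large HW hN k1 sumW detA a0 Aa).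
split=> //.
have k0 : 0 < kappa by apply: lt_le_trans k1.
have ka0 : 0 < kappa * a v by apply: lt_le_trans ka1.
have av : 0 < a v by rewrite -(pmulr_rgt0 _ k0).
set Theta := kappa ^+ (3 * d + 3) * (kappa * a v) ^+ E.
have Theta1 : 1 <= Theta by rewrite -[1]mulr1 ler_pM // exprn_ege1.
have Theta0 : 0 < Theta by apply: lt_le_trans Theta1.
have le : beta v <= Theta.
  apply/bigmax_leP; split=> [|i _]; first exact: ltW.
  have := local_bound HW pi0 pi1 zP hd hN k1 sumW detA pcf a0 Aa i.
  by rewrite mxE Wv.
have lnT : ln Theta = E%:R * ln (a v) + (3 * d + 3 + E)%:R * ln kappa.
  rewrite /Theta lnM ?posrE ?exprn_gt0 // !lnXn // lnM ?posrE //.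
  move: (ln kappa) (ln (a v)) => x y.
  by rewrite -[x *+ _]mulr_natl -[(x + y) *+ _]mulr_natl !natrD; ring.
rewrite -lnT /log_plus ge_max; apply/andP; split; last by rewrite ln_ge0.
have [b0|b0] := ltP 0 (beta v); first by rewrite ler_ln ?posrE.
by rewrite ln0 // ln_ge0.
Qed.

Lemma arch_log_bound v : is_abs v -> arch_place v ->
  log_plus (beta v) <= E%:R * ln (a v) + (3 * d + 3 + E)%:R * ln (maxn 2 N`!)%:R.
Proof.
move=> Hv vQ; have [W [HW WQ]] := algC_abs R.
have [nu vW] := archimedean_embedding iota Hv vQ HW WQ.
pose W' x := W (nu x).
have HW' : is_abs W' by exact: (is_abs_comp nu HW).
have half : W' (2%:R^-1) = 2%:R^-1.
  by rewrite /W' fmorphV rmorph_nat (absV HW) -(ratr_nat algC) WQ normr_nat ratr_nat.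
have W'v x : W' (iota x) = v x by rewrite vW.
have h0 : 0 < W' (2%:R^-1) by rewrite half invr_gt0 ltr0n.
have h1 : W' (2%:R^-1) < 1 by rewrite half invf_lt1 ?ltr0n // ltr1n.
have k1 : 1 <= (maxn 2 N`!)%:R :> R by rewrite ler1n leq_max.
have [|_] // := log_bound_of_extension HW' W'v h0 h1 k1.
move=> I f M cI M0 fM; apply: le_trans (abs_sum HW' _ _ _) _.
apply: le_trans (_ : \sum_(i : I) M <= _); first exact: ler_sum.
by rewrite sumr_const -[M *+ _]mulr_natl ler_wpM2r // ler_nat.
Qed.

Lemma padic_log_bound p v : prime p -> is_abs v -> padic_place p v ->
  1 <= a v /\ log_plus (beta v) <= E%:R * ln (a v).
Proof.
move=> pp Hv vp; have [_ ultra /andP[p0 p1] _] := nonarch_nat pp Hv vp.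
have [|W [HW UW Wv]] := @nonarchimedean_extension R K algC iota v p%:R Hv ultra p0 p1.
  move=> x; have [q [qE mon_q] _] := minCpolyP x.
  exists (map_poly (in_alg K) q); first by rewrite map_poly_eq0 monic_neq0.
  by rewrite -map_poly_comp (eq_map_poly (rmorph_in_alg iota)) -qE root_minCpoly.
have h0 : 0 < W (iota p%:R) by rewrite Wv.
have h1 : W (iota p%:R) < 1 by rewrite Wv.
have [|] := log_bound_of_extension HW Wv h0 h1 (lexx 1).
  by move=> I f M _ M0 fM; rewrite mul1r; apply: ultrametric_sum.
by rewrite mul1r ln1 mulr0 addr0.
Qed.

(** The second alternative is the value given by convention to a sum with
    infinitely many nonzero terms. *)
Lemma height_bound : height_vec R b <= E%:R * height_mx R A + (3 * d + 3 + E)%:R * ln (maxn 2 N`!)%:R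
  \/ height_vec R b = 0.
Proof.
set S := @standard_abs R K; set E' := _ * ln (_)%:R.
pose deg : R := (\dim {:K})%:R.
have deg0 : 0 < deg by rewrite ltr0n adim_gt0.
pose Fb v := local_weight v * log_plus (beta v).
pose Fa v := local_weight v * ln (a v).
have weight0 (v : K -> R) : 0 <= local_weight v by rewrite divr_ge0.
have k1 : 1 <= (maxn 2 N`!)%:R :> R by rewrite ler1n leq_max.
have [finb|] := pselect (finite_set (S `&` Fb @^-1` [set~ 0])); last first.
  by move=> inf; right; exact: (fsbig_dflt _ inf).
left.
pose SI := [set v | [/\ is_abs v, arch_place v & local_degree v != 0%N]].
have arch2 : 1 < ratr `|2%:R : rat| :> R by rewrite normr_nat ratr_nat ltr1n.
have finI : finite_set SI by exact: (finite_places_over (w := fun q => ratr `|q|) arch2).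
have fina : finite_set (S `&` Fa @^-1` [set~ 0]).
  have exc (ij : 'I_N * 'I_N) : exists c, (0 < c)%N /\ forall p v, prime p -> is_abs v ->
      padic_place p v -> 1 < v (A ij.1 ij.2) -> (p %| c)%N.
    by have [c c0 Hc] := padic_denominator iota (A ij.1 ij.2); exists c.
  have [c Hc] := choice exc; pose C := (\prod_ij c ij)%N.
  have C0 : (0 < C)%N by rewrite prodn_gt0 // => ij; have [] := Hc ij.
  pose Sp p := [set v : K -> R | prime p /\ [/\ is_abs v, padic_place p v & local_degree v != 0%N]].
  apply: (@sub_finite_set _ _ (SI `|` \bigcup_(p in `I_C.+1) Sp p)).
    move=> v [Sv /= Fa0].
    have wn0 : local_degree v != 0%N.
      by apply: contra_notN Fa0 => /eqP d0; rewrite /Fa /local_weight d0 mul0r mul0r.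
    have [Hv [arch|[p pp vp]]] := Sv; first by left.
    right; exists p => //=.
    have [a1 _] := padic_log_bound pp Hv vp.
    have a1' : 1 < a v.
      rewrite lt_neqAle a1 andbT; apply: contra_notN Fa0 => /eqP a1'.
      by rewrite /Fa -a1' ln1 mulr0.
    have [i] : exists i, 1 < \big[Num.max/0]_(j < N) v (A i j).
      apply: contrapT => no; move: a1'; rewrite ltNge => /negP; apply.
      apply/bigmax_leP; split=> // i _; rewrite leNgt; apply/negP => lt; apply: no; by exists i.
    move=> lti; have [j ltj] : exists j, 1 < v (A i j).
      apply: contrapT => no; move: lti; rewrite ltNge => /negP; apply.
      apply/bigmax_leP; split=> // j _; rewrite leNgt; apply/negP => lt; apply: no; by exists j.
    have [_ /(_ p v pp Hv vp ltj) pc] := Hc (i, j).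
    rewrite ltnS; apply: dvdn_leq => //; apply: dvdn_trans pc _.
    by rewrite /C (bigD1 (i, j)) //= dvdn_mulr.
  rewrite finite_setU; split=> //; apply: bigcup_finite; first exact: finite_II.
  move=> p _; have [[v0 [pp [Hv0 vp0 _]]]|none] := pselect (exists v, Sp p v); last first.
    by apply: (sub_finite_set _ (finite_set0 _)) => v hv; apply: none; exists v.
  have p1 : 1 < padic_abs R p (p%:R^-1).
    have [_ _ /andP[v0p v0p1] _] := nonarch_nat pp Hv0 vp0.
    rewrite -vp0 -in_algE fmorphV rmorph_nat (absV Hv0) invf_gt1 //.
  by apply: sub_finite_set (finite_places_over p1) => v [].
pose T := (S `&` Fb @^-1` [set~ 0]) `|` (S `&` Fa @^-1` [set~ 0]) `|` SI.
have finT : finite_set T by rewrite !finite_setU.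
have TS : T `<=` S by move=> v [[[]|[]]//|[Hv arch _]]; split=> //; left.
pose r : seq (K -> R) := finmap.enum_fset (fset_set T).
have uniq_r : uniq r by exact: finmap.fset_uniq.
have rE v : (v \in r) = (v \in T) by rewrite in_fset_set.
have rS : [set` r] `<=` S by move=> v /=; rewrite rE inE; exact: TS.
have sumE (F : (K -> R) -> R) : (forall v, S v -> v \notin r -> F v = 0) ->
    \sum_(v \in S) F v = \sum_(v <- r) F v.
  move=> HF; rewrite (@fsbigE _ _ _ _ S r F uniq_r rS HF) big_seq_cond [RHS]big_seq_cond.
  by apply: eq_bigl => v; rewrite andbT andb_idr // => /rS; rewrite inE.
have sumb : height_vec R b = \sum_(v <- r) Fb v.
  apply: sumE => v Sv; rewrite rE => nT; apply: contrapT => Fv; move/negP: nT; apply.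
  by rewrite inE; left; left.
have suma : height_mx R A = \sum_(v <- r) Fa v.
  apply: sumE => v Sv; rewrite rE => nT; apply: contrapT => Fv; move/negP: nT; apply.
  by rewrite inE; left; right.
have E'0 : 0 <= E' by rewrite mulr_ge0 // ln_ge0.
rewrite sumb suma mulr_sumr.
apply: le_trans (_ : \sum_(v <- r) (E%:R * Fa v + (if v \in SI then E' * local_weight v else 0)) <= _).
  rewrite big_seq [leRHS]big_seq; apply: ler_sum => v /rS Sv; have [Hv cases] := Sv.
  have -> : E%:R * Fa v = local_weight v * (E%:R * ln (a v)) by rewrite /Fa mulrCA.
  case: cases => [arch|[p pp vp]]; last first.
    have [_ le] := padic_log_bound pp Hv vp.
    apply: le_trans (ler_wpM2l (weight0 v) le) _; rewrite lerDl.
    by case: ifP => // _; rewrite mulr_ge0.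
  apply: le_trans (ler_wpM2l (weight0 v) (arch_log_bound Hv arch)) _.
  rewrite mulrDr lerD2l; case: ifPn => [_|nI]; first by rewrite mulrC.
  have -> : local_weight v = 0 :> R; last by rewrite mul0r.
  rewrite /local_weight; have [->|d0] := eqVneq (local_degree v) 0%N; first by rewrite mul0r.
  by move/negP: nI; rewrite inE; case.
rewrite big_split /= lerD2l -big_mkcond /= -mulr_sumr -[leRHS]mulr1 ler_wpM2l //.
rewrite /local_weight -mulr_suml ler_pdivrMr // mul1r -natr_sum ler_nat -big_filter.
apply: (sum_local_degree (w := fun q => ratr `|q|) _ arch2); first by rewrite filter_uniq.
by move=> v; rewrite mem_filter => /andP[+ _]; rewrite inE => -[Hv arch _].
Qed.

End Bounds.
End Assembly.

Theorem corollary4 (R : realType) (N d : nat) (B : R)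
    (hN : (1 <= N)%N) (hd : (2 <= d)%N) (hB : 0 <= B) :
  exists C : R,
    forall (A : 'M[algC]_N) (b : 'cV[algC]_N),
      \det A = 1 ->
      PCF (power_affine_map d A b) ->
      forall (K : fieldExtType rat) (iota : {rmorphism K -> algC})
             (AK : 'M[K]_N) (bK : 'cV[K]_N),
        A = map_mx iota AK -> b = map_mx iota bK ->
        height_mx R AK <= B -> height_vec R bK <= C.
Proof.
set e := (N.+1 * d.+1)%N.
exists (e%:R * B + (3 * d + 3 + e)%:R * ln (maxn 2 N`!)%:R).
move=> A b detA pcf K iota AK bK EA Eb hA; rewrite EA in detA; rewrite EA Eb in pcf.
have ln0 : 0 <= ln (maxn 2 N`!)%:R :> R by rewrite ln_ge0 // ler1n leq_max.
have [le|->] := height_bound R hN hd detA pcf; last by rewrite addr_ge0 ?mulr_ge0.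
by apply: le_trans le _; rewrite lerD2r ler_wpM2l.
Qed.
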